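(* Let $n\in\mathbb{N}$ be an odd integer greater than $2$. Denote by $X_{n+1}$ the curve associated with the $(n+1)$-dimensional Barvinok-Novik orbitope $B_{n+1}$, and by $\bar{X}_{n+1}$ its projective closure. The $\frac{n-1}{2}$-th secant variety to $\bar{X}_{n+1}$ is an irreducible component of the algebraic boundary of $B_{n+1}$.
   Context: For an odd integer $n\in\mathbb{N}$, the $(n+1)$-dimensional Barvinok-Novik orbitope $B_{n+1}\subset\mathbb{R}^{n+1}$ is the convex hull of the curve $\{(\cos\theta,\sin\theta,\cos 3\theta,\sin 3\theta,\ldots,\cos n\theta,\sin n\theta) : \theta\in[0,2\pi]\}$ (all odd frequencies from $1$ to $n$). All varieties are defined over $\mathbb{R}$ (zero sets in complex affine or projective space of real polynomials), and the Zariski topology is the $\mathbb{R}$-Zariski topology, whose closed sets are these. The curve $X_{n+1}\subset\mathbb{A}^{n+1}$ associated with $B_{n+1}$ is the Zariski closure of this trigonometric curve; $\bar X_{n+1}$ is its projective closure with respect to $\mathbb{A}^{n+1}\to\mathbb{P}^{n+1}$, $(x_1,\ldots,x_{n+1})\mapsto(1:x_1:\ldots:x_{n+1})$. The algebraic boundary of a semi-algebraic set $S\subset\mathbb{R}^m$ is the Zariski closure in $\mathbb{A}^m$ of its boundary in the euclidean topology. For an embedded quasi-projective variety $X\subset\mathbb{P}^m$, a secant $k$-plane to $X$ is a $k$-dimensional linear space in $\mathbb{P}^m$ spanned by $k+1$ points on $X$, and the $k$-th secant variety of $X$ is the Zariski closure of the union of all secant $k$-planes to $X$; when comparing with the algebraic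 boundary, one considers its affine part in $\mathbb{A}^m$. *)

(* Defs.v *)
From HB Require Import structures.
From mathcomp Require Import all_boot all_order all_algebra.
From mathcomp Require Import boolp classical_sets reals topology normedtype.
From mathcomp Require Import trigo convex.
From mathcomp Require Import complex.
(* The notations of mpoly clash with those of mathcomp-analysis, so
   {mpoly R[m]} is written mpoly m R below. *)
From mathcomp Require Import -(notations) mpoly.

Set Implicit Arguments.
Unset Strict Implicit.
Unset Printing Implicit Defensive.

Import Order.TTheory GRing.Theory Num.Theory.
Import numFieldNormedType.Exports.

Local Open Scope classical_set_scope.
Local Open Scope ring_scope.

(* Value of a real polynomial in m variables at a point of C^m, C = R[i]. *)
Definition ceval (R : realType) (m : nat) (p : mpoly m R)
    (x : 'rV[R[i]]_m) : R[i] :=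
  meval (fun i => x 0 i) (map_mpoly (real_complex R) p).

(* A^m is the set 'rV[R[i]]_m of complex points; its closed sets are the
   complex zero sets of families of real polynomials. *)
Definition zariski_closed (R : realType) (m : nat) (Z : set 'rV[R[i]]_m) :=
  exists S : set (mpoly m R),
    Z = [set x | forall p, S p -> ceval p x = 0].

Definition zariski_closure (R : realType) (m : nat) (A : set 'rV[R[i]]_m) :
    set 'rV[R[i]]_m :=
  smallest (@zariski_closed R m) A.

Definition zariski_irreducible (R : realType) (m : nat)
    (Z : set 'rV[R[i]]_m) :=
  Z !=set0 /\
  forall V W : set 'rV[R[i]]_m, zariski_closed V -> zariski_closed W ->
    Z `<=` V `|` W -> Z `<=` V \/ Z `<=` W.

Definition irreducible_component (R : realType) (m : nat)
    (Z Y : set 'rV[R[i]]_m) :=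
  [/\ Z `<=` Y, zariski_irreducible Z &
      forall Z' : set 'rV[R[i]]_m,
        zariski_irreducible Z' -> Z `<=` Z' -> Z' `<=` Y -> Z' = Z].

Definition real_points (R : realType) (m : nat) (A : set 'rV[R]_m) :
    set 'rV[R[i]]_m :=
  [set map_mx (real_complex R) x | x in A].

(* Points of P^m are the lines through the origin of C^(m+1); more generally,
   the k-dimensional linear spaces in P^m are the (k+1)-dimensional subspaces
   of C^(m+1). *)
Record proj_point (R : realType) (m : nat) := ProjPoint {
  proj_line :> {vspace 'rV[R[i]]_m.+1};
  proj_line_dim : \dim proj_line = 1%N }.

(* Only homogeneous equations are allowed, so that vanishing at one nonzero
   vector of the line L is the same as vanishing on all of L. *)
Definition proj_closed (R : realType) (m : nat) (Z : set (proj_point R m)) :=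
  exists2 S : set (mpoly m.+1 R),
    (forall p, S p -> exists d, p \is ishomog1 d mdeg) &
    Z = [set L | forall p, S p ->
           forall v : 'rV[R[i]]_m.+1, v \in proj_line L -> ceval p v = 0].

Definition proj_closure (R : realType) (m : nat) (A : set (proj_point R m)) :
    set (proj_point R m) :=
  smallest (@proj_closed R m) A.

Definition homog_coord (R : realType) (m : nat) (x : 'rV[R[i]]_m) :
    'rV[R[i]]_m.+1 :=
  row_mx (1%:M : 'rV_1) x.

Lemma homog_coord_dim (R : realType) (m : nat) (x : 'rV[R[i]]_m) :
  \dim <[homog_coord x]>%VS = 1%N.
Proof.
rewrite dim_vline; case: eqP => // /(congr1 (@lsubmx _ 1 1 m)).
rewrite row_mxKl => /matrixP/(_ 0 0)/eqP.
by rewrite !mxE /= oner_eq0.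
Qed.

(* The chart A^m -> P^m, (x_1, ..., x_m) |-> (1 : x_1 : ... : x_m). *)
Definition proj_chart (R : realType) (m : nat) (x : 'rV[R[i]]_m) :
    proj_point R m :=
  ProjPoint (homog_coord_dim x).

Definition affine_part (R : realType) (m : nat) (Z : set (proj_point R m)) :
    set 'rV[R[i]]_m :=
  [set x | Z (proj_chart x)].

(* The condition on the dimension of W says that the k + 1 points spanning it
   are projectively independent. *)
Definition secant_plane (R : realType) (m k : nat) (X : set (proj_point R m))
    (W : {vspace 'rV[R[i]]_m.+1}) :=
  \dim W = k.+1 /\
  exists2 P : 'I_k.+1 -> proj_point R m,
    (forall i, X (P i)) & W = (\sum_i proj_line (P i))%VS.

Definition secant_variety (R : realType) (m k : nat)
    (X : set (proj_point R m)) : set (proj_point R m) :=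
  proj_closure [set L | exists2 W, secant_plane k X W & (L <= W)%VS].

Definition convex_hull (R : realType) (m : nat) (A : set 'rV[R]_m) :
    set 'rV[R]_m :=
  smallest (@convex_set R 'rV[R]_m) A.

Definition algebraic_boundary (R : realType) (m : nat) (S : set 'rV[R]_m) :
    set 'rV[R[i]]_m :=
  zariski_closure (real_points (closure S `\` interior S)).

(* For odd n, coordinates are numbered from 0 to n: coordinate 2j is
   cos ((2j+1) t) and coordinate 2j+1 is sin ((2j+1) t). *)
Definition bn_point (R : realType) (n : nat) (t : R) : 'rV[R]_n.+1 :=
  \row_(i < n.+1) if odd i then sin (i%:R * t) else cos (i.+1%:R * t).

Definition bn_trig_curve (R : realType) (n : nat) : set 'rV[R]_n.+1 :=
  [set bn_point n t | t in `[0, 2 * pi]].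
Arguments bn_trig_curve : clear implicits.

Definition bn_orbitope (R : realType) (n : nat) : set 'rV[R]_n.+1 :=
  convex_hull (bn_trig_curve R n).
Arguments bn_orbitope : clear implicits.

Definition bn_curve (R : realType) (n : nat) : set 'rV[R[i]]_n.+1 :=
  zariski_closure (real_points (bn_trig_curve R n)).
Arguments bn_curve : clear implicits.

Definition bn_proj_curve (R : realType) (n : nat) : set (proj_point R n.+1) :=
  proj_closure [set proj_chart x | x in bn_curve R n].
Arguments bn_proj_curve : clear implicits.

(* Main.v *)
(* Let [n = 2k + 1].  A functional with double zeros at [k + 1] points of a short
   arc of the curve has a derivative that is a product of [n] sines, by counting
   zeros; with the antiperiodicity of odd frequencies this shows that it has one
   sign, so the simplices spanned by such points lie in the boundary of the
   orbitope.  They are Zariski dense in the affine part of the secant variety, one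
   summand at a time, because a trigonometric polynomial with infinitely many
   zeros vanishes; the same argument makes the secant variety irreducible.
   For maximality, the boundary lies in a hypersurface, since the orbitope is
   semialgebraic (Caratheodory and Tarski); and by Terracini's tangent argument no
   nonzero homogeneous polynomial vanishes on the secant variety, which therefore
   has codimension one: a nonzero prime below its ideal is equal to it. *)

From HB Require Import structures.
Require Import Defs.
From mathcomp Require Import all_boot all_order all_algebra.
From mathcomp Require Import boolp classical_sets functions.
From mathcomp Require Import reals interval_inference topology normedtype.
From mathcomp Require Import derive trigo convex.
From mathcomp Require Import complex qe_rcf ordered_qelim.
From mathcomp Require Import -(notations) mpoly.
From mathcomp Require Import separable.
From mathcomp Require Import zify ring lra.

Set Implicit Arguments.
Unset Strict Implicit.
Unset Printing Implicit Defensive.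

Import Order.TTheory GRing.Theory Num.Theory.
Import numFieldNormedType.Exports.

Local Open Scope classical_set_scope.
Local Open Scope ring_scope.

(** * Fourier coefficients on the circle *)

Section Fourier.
Variable R : realType.
Implicit Types (t s : R).
Local Notation C := R[i].

(** All frequencies are odd, so [exp(i n t)] times a functional on the curve is a polynomial of
    degree at most [n] in [w = exp(2 i t)]. Points of the curve are therefore counted modulo [pi],
    and [k + 1] double zeros, one zero more than the degree allows, force the functional to be [0].
    This single fact gives both the independence of the chosen points and the surjectivity of the
    differential in the tangent argument. The arc is [[0, pi/4]] because on such an arc the dips of
    the functional between contact points can be compared with its fall on the way to the antipodal
    arc. Each point has its own subinterval, so that the parameters range freely over a product.
    Dimension theory is replaced by passing to cones: their ideals live in [A[T]], with [A] the
    polynomial ring in the coordinates, and an ideal that meets [A] only in [0] behaves as in the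
    principal ideal domain [K[T]], [K] the fraction field of [A]. Irreducibility and density of sums
    are handled with complex polynomials, since translation by a complex point does not preserve
    real ones. *)

Definition dotr (m : nat) (u v : 'rV[R]_m) : R := \sum_i u 0 i * v 0 i.

Definition circ t : C := (cos t +i* sin t)%C.

Lemma circD s t : circ (s + t) = circ s * circ t.
Proof. by rewrite /circ cosD sinD; simpc; congr (_ +i* _)%C; ring. Qed.

Lemma circ0 : circ 0 = 1.
Proof. by rewrite /circ cos0 sin0. Qed.

Lemma circ_neq0 t : circ t != 0.
Proof.
apply/eqP => ct0; have := circD t (- t).
by rewrite subrr circ0 ct0 mul0r => /eqP; rewrite oner_eq0.
Qed.

Lemma circMn t (j : nat) : circ (j%:R * t) = circ t ^+ j.
Proof.
elim: j => [|j IHj]; first by rewrite mul0r circ0.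
by rewrite mulrSr mulrDl mul1r circD IHj exprSr.
Qed.

Lemma complexi_neq0 : 'i%C != 0 :> C.
Proof. by rewrite eq_complex /= oner_eq0 andbF. Qed.

Lemma circ_subN t : circ t - circ (- t) = 2 * 'i%C * (sin t)%:C%C.
Proof.
rewrite /circ cosN sinN.
have -> : (2 : C) = (2 +i* 0)%C by rewrite -[RHS]/((2%:R)%:C)%C rmorph_nat.
by simpc; congr (_ +i* _)%C; ring.
Qed.

Lemma circ_sqB s t :
  circ t ^+ 2 - circ s ^+ 2 = 2 * 'i%C * circ s * circ t * (sin (t - s))%:C%C.
Proof.
have -> : 2 * 'i%C * circ s * circ t * (sin (t - s))%:C%C
  = circ s * circ t * (2 * 'i%C * (sin (t - s))%:C%C) by ring.
rewrite -circ_subN opprB mulrBr [circ s * circ t]mulrC {1}mulrAC -!mulrA -!circD.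
by rewrite !expr2 -!circD !addrA; congr (circ _ - circ _); ring.
Qed.

Lemma circ_sq_inj s t : `|t - s| < pi -> circ t ^+ 2 = circ s ^+ 2 -> t = s.
Proof.
move=> ts_pi /eqP; rewrite -subr_eq0 circ_sqB !mulf_eq0 !(negPf (circ_neq0 _)).
rewrite pnatr_eq0 (negPf complexi_neq0) /= => /eqP [] s0; apply/eqP; rewrite -subr_eq0; apply/negPn/negP => ne0.
case: (ltgtP (t - s) 0) => [ts_lt0|ts_gt0|]; last by move/eqP: ne0.
  have := @sin_gt0_pi _ (- (t - s)); rewrite sinN s0 oppr0 ltxx => /(_ _)/negP; apply=> //.
  by rewrite oppr_gt0 ts_lt0 -(ltr0_norm ts_lt0).
have := @sin_gt0_pi _ (t - s); rewrite ts_gt0 s0 ltxx => /(_ _)/negP; apply=> //.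
by rewrite -(gtr0_norm ts_gt0).
Qed.

Variable k : nat.
Local Notation n := (k.*2.+1).
Local Notation c := (bn_point n).
Implicit Types (u : 'rV[R]_n.+1).

Lemma sum_ord_double (V : nmodType) (m : nat) (F : nat -> V) :
  \sum_(i < m.*2) F i = \sum_(l < m) (F l.*2 + F l.*2.+1).
Proof.
elim: m => [|m IHm]; first by rewrite !big_ord0.
by rewrite doubleS !big_ord_recr /= IHm addrA.
Qed.

(* The coefficient of [exp (i j t)], [j = 2 l + 1], in [a cos(jt) + b sin(jt)]. *)
Definition fcoef u (l : nat) : C :=
  (u 0 (inord l.*2) / 2 -i* (u 0 (inord l.*2.+1) / 2))%C.

(** The polynomial in [w = exp(2 i t)] equal to [exp(i n t)] times [u . c(t)]. The frequency
    [j = 2l + 1] contributes the exponents [(n + j)/2 = k + l + 1] and [(n - j)/2 = k - l]. *)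
Definition fpoly u : {poly C} :=
  \sum_(l < k.+1) (fcoef u l *: 'X^(k + l.+1) + (fcoef u l)^* *: 'X^(k - l)).

Lemma size_fpoly u : (size (fpoly u) <= n.+1)%N.
Proof.
apply: (leq_trans (size_sum _ _ _)); apply/bigmax_leqP => l _.
apply: (leq_trans (size_polyD _ _)); rewrite geq_max.
apply/andP; split; apply: (leq_trans (size_scale_leq _ _)); rewrite size_polyXn.
  by rewrite ltnS -addnn -addnS leq_add2l.
by rewrite ltnS (leq_trans (leq_subr _ _)) // -addnn -addnS leq_addr.
Qed.

Lemma fpoly_inj u : fpoly u = 0 -> u = 0.
Proof.
move=> P0; have co l : (l < k.+1)%N -> fcoef u l = 0.
  move=> lk; have := congr1 (fun p : {poly C} => p`_(k + l.+1)) P0.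
  rewrite coef0 coef_sum (bigD1 (Ordinal lk)) //= coefD !coefZ !coefXn eqxx mulr1.
  have neq l' : (k + l.+1 == k - l')%N = false.
    by rewrite gtn_eqF // (leq_ltn_trans (leq_subr _ _)) // addnS ltnS leq_addr.
  rewrite neq mulr0 addr0 big1 ?addr0 // => i /eqP il.
  rewrite coefD !coefZ !coefXn neq mulr0 addr0 eqn_add2l eqSS.
  by case: eqP => [li|]; rewrite ?mulr0 //; case: il; apply/val_inj.
apply/rowP => i; rewrite mxE.
have ik : (i./2 < k.+1)%N.
  by rewrite ltn_half_double doubleS.
have [/eqP + /eqP] := co _ ik; rewrite oppr_eq0 !mulf_eq0 !invr_eq0 pnatr_eq0 /= !orbF.
move=> /eqP h1 /eqP h2.
have := odd_double_half i; case: (odd i); rewrite ?add1n ?add0n => e.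
  by rewrite -[RHS]h2 e inord_val.
by rewrite -[RHS]h1 e inord_val.
Qed.

Lemma dotr_bn_point u t :
  dotr u (c t) = \sum_(l < k.+1) (u 0 (inord l.*2) * cos (l.*2.+1%:R * t)
                                + u 0 (inord l.*2.+1) * sin (l.*2.+1%:R * t)).
Proof.
pose F j := u 0 (inord j) * (if odd j then sin (j%:R * t) else cos (j.+1%:R * t)).
have -> : dotr u (c t) = \sum_(i < k.+1.*2) F i.
  by rewrite /dotr; apply: eq_bigr => i _; rewrite /F inord_val mxE.
by rewrite sum_ord_double; apply: eq_bigr => l _; rewrite /F /= odd_double.
Qed.

Lemma fpolyE u t :
  circ t ^+ n * (dotr u (c t))%:C%C = (fpoly u).[circ t ^+ 2].
Proof.
rewrite dotr_bn_point rmorph_sum mulr_sumr /fpoly horner_sum.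
apply: eq_bigr => l _; rewrite hornerD !hornerZ !hornerXn -!exprM.
set j := l.*2.+1.
have lk : (l <= k)%N by rewrite -ltnS.
have -> : (2 * (k + l.+1) = n + j)%N by rewrite mul2n doubleD doubleS addSnnS.
have nE : (n = j + 2 * (k - l))%N.
  by rewrite /j mul2n doubleB addSn subnKC // leq_double.
have -> : circ t ^+ (2 * (k - l)) = circ t ^+ n * circ (- (j%:R * t)).
  by rewrite nE exprD -(circMn t j) [circ (j%:R * t) * _]mulrC -mulrA -circD subrr circ0 mulr1.
rewrite exprD -(circMn t j) [RHS](_ : _ = circ t ^+ n * (fcoef u l * circ (j%:R * t)
  + (fcoef u l)^* * circ (- (j%:R * t)))); last by ring.
congr (_ * _); rewrite /fcoef /circ cosN sinN -/j.
by simpc; congr (_ +i* _)%C; field.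
Qed.

(** Differentiation in [t], written as an operation on coefficient vectors: the derivative of
    [u . c] is again a functional on the curve, so all zero counts apply to it as well. *)
Definition dcoef u : 'rV[R]_n.+1 :=
  \row_(i < n.+1) if odd i then - i%:R * u 0 (inord i.-1)
                  else i.+1%:R * u 0 (inord i.+1).

Lemma fcoef_dcoef u l : (l <= k)%N ->
  fcoef (dcoef u) l = 'i%C * l.*2.+1%:R * fcoef u l.
Proof.
move=> lk; rewrite /fcoef /dcoef !mxE.
have l1 : (l.*2.+1 < n.+1)%N by rewrite !ltnS leq_double.
rewrite !inordK ?(ltnW l1) //= odd_double /=.
have -> : (l.*2.+1%:R : C) = ((l.*2.+1%:R)%:C)%C by rewrite rmorph_nat.
by simpc; congr (_ +i* _)%C; ring.
Qed.

(** For [w = exp(2 i t)], [d/dt] is [2 i w d/dw]; the second term comes from differentiating the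
    factor [exp(- i n t)]. *)
Lemma fpoly_dcoef u :
  fpoly (dcoef u) = ('i%C *+ 2) *: ('X * (fpoly u)^`()) - ('i%C *+ n) *: fpoly u.
Proof.
rewrite /fpoly raddf_sum mulr_sumr !scaler_sumr -sumrB; apply: eq_bigr => l _.
have lk : (l <= k)%N by rewrite -ltnS.
rewrite fcoef_dcoef //= derivD !derivZ !derivXn.
have XX m : ('X : {poly C}) * ('X^(m.-1) *+ m) = m%:R *: 'X^m.
  by case: m => [|m]; rewrite ?mulr0n ?scale0r ?mulr0 //= mulrnAr -exprS scaler_nat.
rewrite mulrDr -!scalerAr !XX.
have -> : ('i%C * l.*2.+1%:R * fcoef u l)^* = - ('i%C * l.*2.+1%:R * (fcoef u l)^*).
  rewrite !rmorphM /= conjC_nat -!mulNr; congr (_ * _ * _).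
  by apply/eqP; rewrite eq_complex /= oppr0 !eqxx.
rewrite -['i%C *+ 2]mulr_natr -['i%C *+ n]mulr_natr.
have dbl1 m : (m.*2.+1%:R : C) = 2 * m%:R + 1.
  by rewrite -addn1 natrD -muln2 natrM mulrC.
rewrite !dbl1 natrB // natrD -[in l.+1%:R]addn1 natrD.
set A := 'X^(k + _); set B := 'X^(k - _).
rewrite !scalerDr !scalerA opprD addrACA -!scalerBl.
by congr (_ *: _ + _ *: _); ring.
Qed.

(* A frequency-[n] antiperiodic trigonometric polynomial has [n + 1] degrees of
   freedom, so [k + 1] double zeros modulo [pi] annihilate it. *)
Lemma double_zeros_eq0 u (t : 'I_k.+1 -> R) :
  (forall i j, i != j -> circ (t i) ^+ 2 != circ (t j) ^+ 2) ->
  (forall i, dotr u (c (t i)) = 0) -> (forall i, dotr (dcoef u) (c (t i)) = 0) ->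
  u = 0.
Proof.
move=> t_inj u0 du0; apply: fpoly_inj.
pose w i := circ (t i) ^+ 2; set P := fpoly u.
have Pw i : P.[w i] = 0 by rewrite -fpolyE u0 mulr0.
have P'w i : P^`().[w i] = 0.
  have := fpolyE (dcoef u) (t i); rewrite du0 mulr0 fpoly_dcoef.
  rewrite hornerD hornerN !hornerZ Pw mulr0 subr0 hornerM hornerX => /esym/eqP.
  rewrite -mulr_natr /w !mulf_eq0 pnatr_eq0 /= ?expf_eq0 !(negPf (circ_neq0 _)).
  by rewrite (negPf complexi_neq0) /= => /eqP.
pose ws := [seq w i | i <- enum 'I_k.+1].
have ws_uniq : uniq ws.
  rewrite map_inj_uniq ?enum_uniq // => i j wij; apply/eqP/negPn/negP => ij.
  by have := t_inj _ _ ij; rewrite -/(w i) -/(w j) wij eqxx.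
pose D : {poly C} := \prod_(z <- ws) ('X - z%:P).
have DP (Q : {poly C}) : (forall i, Q.[w i] = 0) -> D %| Q.
  move=> Q0; have [||Q' ->] := @uniq_roots_prod_XsubC _ Q ws.
  - by apply/allP => _ /mapP[i _ ->]; apply/rootP.
  - by rewrite uniq_rootsE.
  - by rewrite dvdp_mull.
have [Q PQ] := dvdpP _ _ (DP _ Pw).
(* [D] has simple roots, hence is coprime to [D']. From [P = Q D] and [D | P' = Q' D + Q D'] it
   follows that [D | Q], so [D^2] of degree [2k + 2 > n] divides [P]. *)
have /Gauss_dvdpl DQ : coprimep D D^`().
  by have := separable_prod_XsubC ws; rewrite ws_uniq unlock => ->.
have : D %| P^`() by exact: DP.
rewrite PQ derivM dvdp_addr ?(dvdp_mull _ (dvdpp _)) // DQ => /dvdpP[Q' QQ'].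
have [Q'E|Q'0] := eqVneq Q' 0; first by rewrite QQ' Q'E !mul0r.
have D_size : size D = k.+2 by rewrite size_prod_XsubC size_map size_enum_ord.
have D0 : D != 0 by rewrite -size_poly_gt0 D_size.
have := size_fpoly u; rewrite -/P PQ QQ' -mulrA size_mul ?mulf_neq0 // size_mul //.
rewrite D_size; move: Q'0; rewrite -size_poly_gt0; case: (size _) => // q _.
by rewrite -addnn !addSn !addnS /= !ltnS ltnNge leq_addl.
Qed.

End Fourier.

(** * Supporting hyperplanes at points of a short arc *)

Section SupportingFunctional.
Variables (R : realType) (k : nat).
Implicit Types (t s : R).
Local Notation n := (k.*2.+1).
Local Notation c := (bn_point n).
Implicit Types (u : 'rV[R]_n.+1).

Lemma is_derive_bn u t :
  is_derive t 1 (fun t => dotr u (c t)) (dotr (dcoef u) (c t)).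
Proof.
rewrite (_ : (fun t => _) = \sum_(l < k.+1) (fun t : R =>
   u 0 (inord l.*2) * cos (l.*2.+1%:R * t) + u 0 (inord l.*2.+1) * sin (l.*2.+1%:R * t)));
  last by apply/funext => s; rewrite dotr_bn_point fct_sumE.
rewrite dotr_bn_point.
apply: is_derive_sum => l.
have lk : (l.*2.+1 < n.+1)%N by rewrite !ltnS leq_double -ltnS.
apply: is_derive_eq.
rewrite /dcoef !mxE !inordK ?(ltnW lk) //= odd_double /= /GRing.scale /=.
by ring.
Qed.

Lemma bn_point_pi t : c (t + pi) = - c t.
Proof.
have h (j : nat) : odd j -> circ (j%:R * (t + pi)) = - circ (j%:R * t).
  move=> oj; rewrite !circMn circD.
  have -> : circ (pi : R) = -1.
    by rewrite /circ cospi sinpi; apply/eqP; rewrite eq_complex /= oppr0 !eqxx.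
  by rewrite mulrN1 exprNn -signr_odd oj mulN1r.
apply/rowP => i; rewrite !mxE; case: ifP => oi.
  by have [] := h i oi.
by have [] : circ (i.+1%:R * (t + pi)) = - circ (i.+1%:R * t); first by apply: h; rewrite /= oi.
Qed.

Lemma mvt_bn u a b : a <= b ->
  exists2 x, a <= x <= b &
    dotr u (c b) - dotr u (c a) = dotr (dcoef u) (c x) * (b - a).
Proof.
move=> ab; have [|x xab ->] := MVT_segment (f := fun t => dotr u (c t)) ab
    (fun x _ => is_derive_bn u x); last first.
  by exists x => //; move: xab; rewrite in_itv.
apply: continuous_subspaceT => y.
by apply/differentiable_continuous/derivable1_diffP; have [] := is_derive_bn u y.
Qed.

Lemma common_kernel (m : nat) (g : 'I_m -> 'rV[R]_m.+1 -> R) :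
  (forall j, scalar (g j)) -> exists2 x, x != 0 & forall j, g j x = 0.
Proof.
move=> g_lin; pose A := \matrix_(i, j) g j (delta_mx 0 i).
have : kermx A != 0.
  by rewrite kermx_eq0 /row_free neq_ltn (leq_ltn_trans (rank_leq_col A)).
case/rowV0Pn => x /sub_kermxP xA x0; exists x => // j.
have g_sum (I : finType) (a : I -> R) (y : I -> 'rV[R]_m.+1) :
    g j (\sum_i a i *: y i) = \sum_i a i * g j (y i).
  have g0 : g j 0 = 0.
    by have := g_lin j (-1) 0 0; rewrite scaler0 addr0 mulN1r addNr.
  elim/big_ind2: _ => // [v p w q vp wq|i _].
    by have := g_lin j 1 p q; rewrite scale1r mul1r vp wq.
  by have := g_lin j (a i) (y i) 0; rewrite g0 !addr0.
rewrite (row_sum_delta x) g_sum.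
have := congr1 (fun M : 'rV_m => M 0 j) xA; rewrite !mxE => {2}<-.
by apply: eq_bigr => i _; rewrite mxE.
Qed.

Lemma dotrDl m (a : R) (u v w : 'rV[R]_m) :
  dotr (a *: u + v) w = a * dotr u w + dotr v w.
Proof.
rewrite /dotr mulr_sumr -big_split; apply: eq_bigr => i _.
by rewrite !mxE mulrDl mulrA.
Qed.

Lemma dcoefD (a : R) u v : dcoef (a *: u + v) = a *: dcoef u + dcoef v.
Proof. by apply/rowP => i; rewrite !mxE; case: ifP => _; ring. Qed.

(** A dimension count: the pair [(c0, u)] has [n + 2] unknowns, and a value and a tangency at each
    of the [k + 1] points make [n + 1] linear conditions. Coordinate [0] of [x] is [c0]; even [j]
    encode values, odd [j] tangencies. *)
Lemma tangent_functional (t : 'I_k.+1 -> R) : exists c0 u,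
  [/\ u != 0, forall i, dotr u (c (t i)) = c0
     & forall i, dotr (dcoef u) (c (t i)) = 0].
Proof.
pose U (x : 'rV[R]_n.+2) : 'rV[R]_n.+1 := \row_i x 0 (lift 0 i).
have U_lin a x y : U (a *: x + y) = a *: U x + U y by apply/rowP => i; rewrite !mxE.
pose g (j : 'I_n.+1) (x : 'rV[R]_n.+2) :=
  if odd j then dotr (dcoef (U x)) (c (t (inord j./2)))
  else dotr (U x) (c (t (inord j./2))) - x 0 0.
have [|x x0 gx] := @common_kernel _ g.
  move=> j a x y; rewrite /g; case: ifP => _; first by rewrite U_lin dcoefD dotrDl.
  by rewrite U_lin dotrDl !mxE; ring.
have gE (i : 'I_k.+1) (b : bool) : exists2 j : 'I_n.+1, odd j = b & j./2 = i.
  have ib : (b + i.*2 < n.+1)%N.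
    by rewrite ltnS -[n]add1n leq_add ?leq_b1 // leq_double -ltnS ltn_ord.
  exists (Ordinal ib); first by rewrite /= oddD odd_double addbF oddb.
  by rewrite /= half_bit_double.
have h1 i : dotr (U x) (c (t i)) = x 0 0.
  have [j oj ji] := gE i false; have := gx j.
  by rewrite /g oj ji inord_val => /eqP; rewrite subr_eq0 => /eqP.
exists (x 0 0), (U x); split=> //; last first.
  by move=> i; have [j oj ji] := gE i true; have := gx j; rewrite /g oj ji inord_val.
(* If [u] were [0], the value [c0] would be [0] too, and with it the whole solution [x]. *)
apply: contra x0 => /eqP Ux0; apply/eqP/rowP => i; rewrite mxE.
case: (unliftP 0 i) => [j|] ->.
  by have := congr1 (fun v : 'rV_n.+1 => v 0 j) Ux0; rewrite !mxE.
by rewrite -(h1 ord0) Ux0 /dotr big1 // => j _; rewrite mxE mul0r.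
Qed.

(** The [n] zeros exhaust the degree of [fpoly u], so it is a constant times the product of the
    [w - w_z]. By [circ_sqB] each factor is a sine up to [2 i circ z circ s], and the [n] powers of
    [circ s] cancel against [circ s ^+ n]. Both sides being real, the real part of the constant
    suffices. *)
Lemma sine_product u (zs : seq R) : size zs = n -> uniq zs ->
  {in zs &, forall x y, `|x - y| < pi} ->
  {in zs, forall z, dotr u (c z) = 0} ->
  exists C, forall s, dotr u (c s) = C * \prod_(z <- zs) sin (s - z).
Proof.
move=> zs_size zs_uniq zs_pi u0; set P := fpoly u.
pose ws := [seq circ z ^+ 2 | z <- zs].
have ws_uniq : uniq ws.
  rewrite map_inj_in_uniq // => x y xz yz xy.
  by apply: circ_sq_inj xy; exact: zs_pi.
have [||Q PQ] := @uniq_roots_prod_XsubC _ P ws.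
- apply/allP => _ /mapP[z zz ->]; apply/rootP.
  by rewrite -fpolyE u0 // mulr0.
- by rewrite uniq_rootsE.
have Q1 : (size Q <= 1)%N.
  have [->|Q0] := eqVneq Q 0; first by rewrite size_poly0.
  have := size_fpoly u; rewrite -/P PQ size_mul //; last first.
    by rewrite -size_poly_gt0 size_prod_XsubC.
  by rewrite size_prod_XsubC size_map zs_size addnS /= -[X in (_ <= X)%N]add1n leq_add2r.
pose K := Q`_0 * \prod_(z <- zs) (2 * 'i%C * circ z).
exists (complex.Re K) => s.
have : (dotr u (c s))%:C%C = K * (\prod_(z <- zs) sin (s - z))%:C%C.
  apply: (mulfI (x := circ s ^+ n)); first by rewrite expf_neq0 // circ_neq0.
  rewrite fpolyE -/P PQ hornerM (size1_polyC Q1) hornerC /K.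
  rewrite horner_prod big_map rmorph_prod /=.
  have -> : circ s ^+ n = \prod_(z <- zs) circ s.
    by rewrite big_const_seq count_predT zs_size -Monoid.iteropE.
  rewrite mulrCA -!mulrA; congr (_ * _); rewrite mulrCA -!big_split /=.
  by apply: eq_bigr => z _; rewrite hornerXsubC circ_sqB; ring.
case: K => a b; simpc => -[-> _] /=; ring.
Qed.

End SupportingFunctional.

(** * Signs and bounds of a product of sines with nodes on a short arc *)

Section Nodes.
Variables (R : realType) (k : nat) (t r : nat -> R).
Hypothesis tr : forall i, (i < k)%N -> t i < r i < t i.+1.

(** The list [t 0, r 0, t 1, ..., r (m-1), t m]: the contact points, interlaced with the zeros of
    the derivative that Rolle's theorem puts between them. *)
Fixpoint nodes (m : nat) : seq R :=
  if m is m'.+1 then rcons (rcons (nodes m') (r m')) (t m) else [:: t 0].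

Lemma size_nodes m : size (nodes m) = m.*2.+1.
Proof. by elim: m => //= m IHm; rewrite !size_rcons IHm. Qed.

Lemma nodes_le i j : (i <= j <= k)%N -> t i <= t j.
Proof.
elim: j => [|j IHj]; first by rewrite leqn0 => /andP[/eqP -> _].
rewrite leq_eqVlt => /andP[/orP[/eqP -> //|]].
rewrite ltnS => ij jk; rewrite (le_trans (IHj _)) ?ij 1?ltnW //.
by have /andP[? ?] := tr jk; apply/ltW/(lt_trans (y := r j)).
Qed.

Lemma mem_nodes m z : (m <= k)%N -> z \in nodes m -> t 0 <= z <= t m.
Proof.
elim: m => [|m IHm] mk /=; first by rewrite inE => /eqP ->; rewrite lexx.
have /andP[tr1 rt1] := tr mk; have t0m := @nodes_le 0 m (ltnW mk).
rewrite mem_rcons inE mem_rcons inE => /or3P[/eqP ->|/eqP ->|/(IHm (ltnW mk)) /andP[-> zm]].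
- by rewrite lexx (@nodes_le 0 m.+1).
- by rewrite (ltW rt1) (le_trans t0m (ltW tr1)).
- by rewrite (le_trans zm) // (le_trans (ltW tr1)) // ltW.
Qed.

Lemma uniq_nodes m : (m <= k)%N -> uniq (nodes m).
Proof.
elim: m => [|m IHm] mk //=; have /andP[tr1 rt1] := tr mk.
rewrite !rcons_uniq IHm ?(ltnW mk) // andbT mem_rcons inE negb_or.
rewrite gt_eqF //=; apply/andP; split; apply/negP => /(mem_nodes (ltnW mk)) /andP[_].
  by rewrite leNgt (lt_trans tr1).
by rewrite leNgt tr1.
Qed.

(** [r i] is paired with [t (i+1)]: at [s] on the arc the two sines have opposite signs only when
    [s] lies between these two nodes, so the sign of the product can be read off. *)
Lemma prod_nodes m (F : R -> R) :
  \prod_(z <- nodes m) F z = F (t 0) * \prod_(i < m) (F (r i) * F (t i.+1)).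
Proof.
elim: m => [|m IHm] /=; first by rewrite big_seq1 big_ord0 mulr1.
by rewrite !big_rcons IHm big_ord_recr /= !mulrA.
Qed.

Hypothesis t_short : t k - t 0 <= pi / 4.

Local Ltac pi_lra := have := pi_gt0 R; move: t_short => ? ?; lra.

Let sin_ge0 (x : R) : 0 <= x <= pi -> 0 <= sin x.
Proof. exact: sin_ge0_pi. Qed.

Let sin_le0 (x : R) : - pi <= x <= 0 -> sin x <= 0.
Proof. by move=> ?; rewrite -oppr_ge0 -sinN sin_ge0 //; pi_lra. Qed.

Lemma node_bounds i : (i < k)%N ->
  [/\ t 0 <= t i, t i <= r i, r i <= t i.+1 & t i.+1 <= t k].
Proof.
move=> ik; have /andP[h1 h2] := tr ik; split; rewrite ?(ltW h1) ?(ltW h2) //.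
  by rewrite nodes_le //= ltnW.
by rewrite nodes_le //= ik /=.
Qed.

Let g s : R := \prod_(z <- nodes k) sin (s - z).

Lemma sine_nodes_ge0 s j : (j < k)%N -> t j <= s <= r j -> 0 <= g s.
Proof.
move=> jk sj; have [h1 h2 h3 h4] := node_bounds jk.
rewrite /g prod_nodes mulr_ge0 //; first by apply: sin_ge0; pi_lra.
rewrite prodr_ge0 // => i _; have [i1 i2 i3 i4] := node_bounds (ltn_ord i).
have [ij|ji] := ltnP i j.
  have : t i.+1 <= t j by rewrite nodes_le // ij ltnW.
  by move=> h; rewrite mulr_ge0 //; apply: sin_ge0; pi_lra.
have : r j <= r i.
  move: ji; rewrite leq_eqVlt => /orP[/eqP -> //|ji].
  have : t j.+1 <= t i by rewrite nodes_le // ji ltnW.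
  pi_lra.
by move=> h; rewrite mulr_le0 //; apply: sin_le0; pi_lra.
Qed.

Lemma sine_nodes_le0 s j : (j < k)%N -> r j <= s <= t j.+1 -> g s <= 0.
Proof.
move=> jk sj; have [h1 h2 h3 h4] := node_bounds jk.
rewrite /g prod_nodes mulr_ge0_le0 //; first by apply: sin_ge0; pi_lra.
rewrite (bigD1 (Ordinal jk)) //= mulr_le0_ge0 //.
  by rewrite mulr_ge0_le0 //; [apply: sin_ge0|apply: sin_le0]; pi_lra.
rewrite prodr_ge0 // => i /eqP/val_eqP/= ij; have [i1 i2 i3 i4] := node_bounds (ltn_ord i).
move: ij; rewrite neq_ltn => /orP[] ij.
  have : t i.+1 <= t j by rewrite nodes_le // ij ltnW.
  by move=> h; rewrite mulr_ge0 //; apply: sin_ge0; pi_lra.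
have : t j.+1 <= t i by rewrite nodes_le // ij ltnW.
by move=> h; rewrite mulr_le0 //; apply: sin_le0; pi_lra.
Qed.

Lemma sine_nodes_far_ge0 s : t k <= s <= t 0 + pi -> 0 <= g s.
Proof.
move=> sk; rewrite /g big_seq prodr_ge0 // => z /(mem_nodes (leqnn k)) zk.
by apply: sin_ge0; pi_lra.
Qed.

(** A threshold for both bounds below: on the arc all factors are at most [sin (pi/4)] in absolute
    value, while for [s] between [t k + pi/4] and [t k + pi/2] each [s - z] lies in
    [[pi/4, 3 pi/4]], where the sine is at least [sin (pi/4)]. *)
Let q : R := sin (pi / 4) ^+ k.*2.+1.

Lemma sin_le_pihalf (x y : R) :
  - (pi / 2) <= x -> x <= y -> y <= pi / 2 -> sin x <= sin y.
Proof. by move=> ? ? ?; rewrite leNgt ltr_sin ?in_itv /= -?leNgt //; pi_lra. Qed.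

Lemma sin_norm_le (x : R) : `|x| <= pi / 4 -> `|sin x| <= sin (pi / 4).
Proof.
rewrite ler_norml => /andP[x1 x2]; rewrite ler_norml -sinN.
by rewrite !sin_le_pihalf //; pi_lra.
Qed.

Lemma sine_nodes_norm s : t 0 <= s <= t k -> `|g s| <= q.
Proof.
move=> sk; rewrite /g /q -(size_nodes k) normr_prod big_seq.
have -> : sin (pi / 4) ^+ size (nodes k)
    = \prod_(z <- nodes k | z \in nodes k) sin (pi / 4 : R).
  by rewrite -big_seq big_const_seq count_predT -Monoid.iteropE.
apply: ler_prod => z /(mem_nodes (leqnn k)) zk.
by rewrite normr_ge0 sin_norm_le // ler_norml; pi_lra.
Qed.

Lemma sine_nodes_lower s : t k + pi / 4 <= s <= t k + pi / 2 -> q <= g s.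
Proof.
move=> sk; rewrite /g /q -(size_nodes k) big_seq.
have -> : sin (pi / 4) ^+ size (nodes k)
    = \prod_(z <- nodes k | z \in nodes k) sin (pi / 4 : R).
  by rewrite -big_seq big_const_seq count_predT -Monoid.iteropE.
apply: ler_prod => z /(mem_nodes (leqnn k)) zk.
rewrite sin_ge0 /=; last by pi_lra.
have [sz|sz] := lerP (s - z) (pi / 2); first by rewrite sin_le_pihalf //; pi_lra.
have -> : sin (s - z) = sin (pi - (s - z)) by rewrite [RHS]sinB sinpi cospi; ring.
by rewrite sin_le_pihalf //; pi_lra.
Qed.

End Nodes.

(** * The functional tangent at the chosen points is maximal there *)

Section SupportingHyperplane.
Variables (R : realType) (k : nat).
Local Notation n := (k.*2.+1).
Local Notation c := (bn_point n).

Lemma bn_point_2pi (t : R) : c (t + 2 * pi) = c t.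
Proof. by rewrite mulrDl mul1r addrA !bn_point_pi opprK. Qed.

Lemma dotrNl m (u v : 'rV[R]_m) : dotr (- u) v = - dotr u v.
Proof. by rewrite /dotr -sumrN; apply: eq_bigr => i _; rewrite mxE mulNr. Qed.

Lemma dotrNr m (u v : 'rV[R]_m) : dotr u (- v) = - dotr u v.
Proof. by rewrite /dotr -sumrN; apply: eq_bigr => i _; rewrite mxE mulrN. Qed.

Lemma dcoefN (u : 'rV[R]_n.+1) : dcoef (- u) = - dcoef u.
Proof. by apply/rowP => i; rewrite !mxE; case: ifP => _; ring. Qed.

Lemma rolle_nodes (t : nat -> R) (u : 'rV[R]_n.+1) :
  (forall i, (i < k)%N -> t i < t i.+1) ->
  (forall i j, (i <= k)%N -> (j <= k)%N -> dotr u (c (t i)) = dotr u (c (t j))) ->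
  exists r : nat -> R, forall i, (i < k)%N ->
    t i < r i < t i.+1 /\ dotr (dcoef u) (c (r i)) = 0.
Proof.
move=> t_incr ut; pose P i x := (i < k)%N ->
    t i < x < t i.+1 /\ dotr (dcoef u) (c x) = 0.
have /choice[r rP] : forall i, exists x, P i x; last by exists r.
move=> i; case: (ltnP i k) => ik; last by exists 0; rewrite /P ltnNge ik.
have [||||x xt dx] := @Rolle _ (fun s => dotr u (c s)) (t i) (t i.+1).
- exact: t_incr.
- by move=> x _; have [] := is_derive_bn u x.
- apply: continuous_subspaceT => y.
  by apply/differentiable_continuous/derivable1_diffP; have [] := is_derive_bn u y.
- by apply: ut => //; exact: ltnW.
exists x => _; split; first by move: xt; rewrite in_itv.
by have [_ <-] := is_derive_bn u x; have [_ ->] := dx.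
Qed.

(* [phi s = u . c(s)] satisfies [phi' = C * g], [g] the product of sines at the
   nodes, with [C <= 0].  It returns to [c0] at each [t j], decreases then
   increases in between, and decreases from [t k] to [t 0 + pi], where
   antiperiodicity gives it the value [- c0]. *)
Lemma supporting_functional_signed (t r : nat -> R) (u : 'rV[R]_n.+1) (C c0 : R) :
  (forall i, (i < k)%N -> t i < r i < t i.+1) ->
  0 <= t 0 -> t k <= pi / 4 -> C <= 0 ->
  (forall s, dotr (dcoef u) (c s) = C * \prod_(z <- nodes t r k) sin (s - z)) ->
  (forall i, (i <= k)%N -> dotr u (c (t i)) = c0) ->
  forall s, 0 <= s <= 2 * pi -> dotr u (c s) <= c0.
Proof.
move=> tr t0 tk C0 du ut; have pi0 := pi_gt0 R.
have t_short : t k - t 0 <= pi / 4 by lra.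
have t0k : t 0 <= t k by apply: (nodes_le tr); rewrite leqnn.
pose phi s := dotr u (c s); pose q : R := sin (pi / 4) ^+ n.
have phi_t0pi : phi (t 0 + pi) = - c0 by rewrite /phi bn_point_pi dotrNr ut.
have q0 : 0 <= q by rewrite exprn_ge0 // sin_ge0_pi //; lra.
have Cq0 : C * q <= 0 by rewrite mulr_le0_ge0.
have far a b : t k <= a -> a <= b -> b <= t 0 + pi -> phi b <= phi a.
  move=> ka ab bt; have [x xab] := mvt_bn u ab; rewrite -/(phi _) -/(phi _) du => e.
  have g0 : 0 <= \prod_(z <- nodes t r k) sin (x - z).
    by apply: (sine_nodes_far_ge0 tr t_short); lra.
  by rewrite -subr_le0 e mulr_le0_ge0 ?subr_ge0 // mulr_le0_ge0.
(* Over [[t k + pi/4, t k + pi/2]] the functional falls by at least [-C q pi/4], and its total fall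
   from [t k] to [t 0 + pi] is [2 c0]. So a dip of size [-C q pi/4] below [c0] stays above [-c0]. *)
have low : - c0 <= c0 + C * q * (pi / 4).
  have [|x xab] := @mvt_bn _ _ u (t k + pi / 4) (t k + pi / 2); first by lra.
  rewrite -/(phi _) -/(phi _) du => e.
  have g0 : q <= \prod_(z <- nodes t r k) sin (x - z).
    by apply: (sine_nodes_lower tr t_short).
  have h1 : phi (t k + pi / 4) <= c0.
    by rewrite -(ut k) //; apply: far; lra.
  have h2 : phi (t 0 + pi) <= phi (t k + pi / 2) by apply: far; lra.
  have : C * \prod_(z <- nodes t r k) sin (x - z) * (pi / 4) <= C * q * (pi / 4).
    by rewrite ler_wpM2r ?ler_wnM2l //; lra.
  move: e; rewrite -phi_t0pi (_ : t k + pi / 2 - _ = pi / 4); last by lra.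
  by move: (C * _ * _) (C * _ * _) => v w; lra.
(* Between contact points the slope is at most [-C q] in absolute value and the length at most
   [pi/4]; the value is compared with the nearest contact point on the same side of [r j]. *)
have near s j : (j < k)%N -> t j <= s <= t j.+1 ->
    c0 + C * q * (pi / 4) <= phi s <= c0.
  move=> jk sj; have [h1 h2 h3 h4] := node_bounds tr jk.
  have slope a b x : t 0 <= a -> b <= t k -> a <= x <= b ->
      C * q * (pi / 4) <= C * `|\prod_(z <- nodes t r k) sin (x - z)| * (b - a).
    move=> ta bk xab.
    have gq : `|\prod_(z <- nodes t r k) sin (x - z)| <= q.
      by apply: (sine_nodes_norm tr t_short); lra.
    have ba : 0 <= b - a <= pi / 4 by lra.
    rewrite -!mulrA ler_wnM2l // ler_pM //; lra.
  have [sr|rs] := lerP s (r j).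
    have [|x xab] := @mvt_bn _ _ u (t j) s; first by lra.
    rewrite -/(phi _) -/(phi _) du /phi ut ?(ltnW jk) // => e.
    have g0 : 0 <= \prod_(z <- nodes t r k) sin (x - z).
      by apply: (sine_nodes_ge0 tr t_short jk); lra.
    have := @slope (t j) s x; rewrite (ger0_norm g0) -e => /(_ _ _ xab) h.
    have e0 : dotr u (c s) - c0 <= 0.
      by rewrite e mulr_le0_ge0 ?subr_ge0 // ?mulr_le0_ge0 //; lra.
    by have := h h1; lra.
  have [|x xab] := @mvt_bn _ _ u s (t j.+1); first by lra.
  rewrite -/(phi _) -/(phi _) du /phi ut // => e.
  have g0 : \prod_(z <- nodes t r k) sin (x - z) <= 0.
    by apply: (sine_nodes_le0 tr t_short jk); lra.
  have := @slope s (t j.+1) x; rewrite (ler0_norm g0) mulrN mulNr -e => /(_ _ _ xab) h.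
  have e0 : 0 <= c0 - dotr u (c s).
    by rewrite e mulr_ge0 ?subr_ge0 // ?mulr_le0 //; lra.
  by have := h; lra.
(* The lower bound is what matters on the other half period, where antiperiodicity turns it into an
   upper bound. *)
have half s : t 0 <= s <= t 0 + pi -> - c0 <= phi s <= c0.
  move=> s0pi; have [ks|sk] := lerP (t k) s.
    have := far _ _ ks (proj2 (andP s0pi)) (lexx _).
    have := far (t k) s (lexx _) ks (proj2 (andP s0pi)).
    by rewrite phi_t0pi /phi ut // => ? ?; lra.
  have [j jk sj] : exists2 j, (j < k)%N & t j <= s <= t j.+1.
    have ts0 : t 0 <= s by lra.
    suff : forall m, (m <= k)%N -> s < t m ->
        exists2 j, (j < k)%N & t j <= s <= t j.+1 by apply; first exact: leqnn.
    elim=> [|m IHm] mk sm; first by move: (lt_le_trans sm ts0); rewrite ltxx.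
    have [tms|stm] := lerP (t m) s; first by exists m; rewrite ?tms ?ltW.
    by apply: IHm => //; exact: ltnW.
  by have := near s j jk sj; lra.
have full s : t 0 <= s <= t 0 + 2 * pi -> phi s <= c0.
  move=> s2; have [sp|ps] := lerP s (t 0 + pi).
    by have := half s; lra.
  have -> : phi s = - phi (s - pi) by rewrite /phi -[s in LHS](subrK pi) bn_point_pi dotrNr.
  have : - c0 <= phi (s - pi) <= c0 by apply: half; lra.
  by move: (phi _) => v; lra.
move=> s s2; have [ts|st] := lerP (t 0) s; first by apply: full; lra.
by rewrite -bn_point_2pi; apply: full; lra.
Qed.

(** The derivative vanishes at the [k + 1] contact points and at [k] Rolle points, which makes the
    [n] zeros that [sine_product] asks for. The sign of its constant is not known in advance; if it
    is positive, [u] is replaced by [- u]. *)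
Lemma supporting_functional (t : nat -> R) :
  (forall i, (i < k)%N -> t i < t i.+1) -> 0 <= t 0 -> t k <= pi / 4 ->
  exists c0 u, [/\ u != 0, forall i, (i <= k)%N -> dotr u (c (t i)) = c0
    & forall s, 0 <= s <= 2 * pi -> dotr u (c s) <= c0].
Proof.
move=> t_incr t0 tk.
have [c0 [u [u0 ut dut]]] := tangent_functional (fun i : 'I_k.+1 => t i).
have {}ut i : (i <= k)%N -> dotr u (c (t i)) = c0.
  by move=> ik; have := ut (inord i); rewrite inordK.
have {}dut i : (i <= k)%N -> dotr (dcoef u) (c (t i)) = 0.
  by move=> ik; have := dut (inord i); rewrite inordK.
have [|r rP] := rolle_nodes t_incr (u := u).
  by move=> i j ik jk; rewrite !ut.
have tr i : (i < k)%N -> t i < r i < t i.+1 by move=> /rP[].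
have [|||z|C CP] := @sine_product _ _ (dcoef u) (nodes t r k).
- by rewrite size_nodes.
- exact: (uniq_nodes tr).
- move=> x y /(mem_nodes tr (leqnn k)) xk /(mem_nodes tr (leqnn k)) yk.
  by rewrite ltr_norml; have := pi_gt0 R; lra.
- suff : forall m, (m <= k)%N -> z \in nodes t r m -> dotr (dcoef u) (c z) = 0 by apply.
  elim=> [|m IHm] mk /=; first by rewrite inE => /eqP ->; rewrite dut.
  rewrite mem_rcons inE mem_rcons inE => /or3P[/eqP ->|/eqP ->|]; first exact: dut.
    by have [] := rP _ mk.
  exact/IHm/ltnW.
have [C0|C0] := lerP C 0.
  by exists c0, u; split=> //; apply: (supporting_functional_signed tr t0 tk C0 CP).
exists (- c0), (- u); split; rewrite ?oppr_eq0 //; first by move=> i ik; rewrite dotrNl ut.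
apply: (@supporting_functional_signed t r (- u) (- C)) => //; first by lra.
  by move=> s; rewrite dcoefN dotrNl CP mulNr.
by move=> i ik; rewrite dotrNl ut.
Qed.

End SupportingHyperplane.

(** * Nonzero primes over zero in a polynomial ring *)

Lemma exists_min_size (A : nzRingType) (P : {poly A} -> Prop) f : P f -> f != 0 ->
  exists q, [/\ P q, q != 0 & forall h, P h -> h != 0 -> (size q <= size h)%N].
Proof.
move=> Pf f0; pose s m := `[< exists h, [/\ P h, h != 0 & size h = m] >].
have ex_s : exists m, s m by exists (size f); apply/asboolP; exists f.
case: (ex_minnP ex_s) => _ /asboolP[q [Pq q0 <-]] q_min.
exists q; split=> // h Ph h0; apply: q_min; apply/asboolP.
by exists h.
Qed.

(* Over the fraction field [K] of [A], nonzero primes of [K[X]] are maximal;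
   pseudo-division replaces the passage to [K]. *)
Lemma prime_over_zero_maximal (A : idomainType) (P Q : {poly A} -> Prop) :
  (forall f g, P f -> P (g * f)) ->
  (forall f g, P (f * g) -> P f \/ P g) ->
  (forall f, P f -> Q f) ->
  (forall f g, Q f -> Q g -> Q (f - g)) -> (forall f g, Q f -> Q (g * f)) ->
  (forall c : A, Q c%:P -> c = 0) ->
  (exists2 f, P f & f != 0) ->
  forall f, Q f -> P f.
Proof.
move=> PM Pprime PQ QB QM Qc [f0 Pf0 f0_neq0].
have [q [Qq q0 q_min]] := exists_min_size (PQ _ Pf0) f0_neq0.
(* [q] has least size in [Q], [f] in [P]. Pseudo-division by [q] leaves a remainder in [Q], hence
   [0]: up to a power of the leading coefficient, [q] divides all of [Q]. *)
have [f [Pf f_neq0 f_min]] := exists_min_size Pf0 f0_neq0.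
pose lc g := lead_coef q ^+ scalp g q.
have lc0 g : lc g != 0 by rewrite expf_neq0 // lead_coef_eq0.
have q_dvd g : Q g -> (lc g)%:P * g = g %/ q * q.
  move=> Qg; rewrite mul_polyC (Pdiv.Idomain.divp_eq g q) -[RHS]addr0; congr (_ + _).
  apply/eqP/negPn/negP => r0.
  have Qr : Q (g %% q).
    have -> : g %% q = (lc g)%:P * g - g %/ q * q.
      by rewrite mul_polyC (Pdiv.Idomain.divp_eq g q) addrAC subrr add0r.
    by apply: QB; apply: QM.
  by have := q_min _ Qr r0; rewrite leqNgt Pdiv.Idomain.ltn_modp q0.
have q_gt1 : (1 < size q)%N.
  rewrite ltnNge; apply/negP => /size1_polyC qE.
  by move: q0 Qq; rewrite qE polyC_eq0 => /eqP + /Qc.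
(* [q] is not constant, so the quotient of [f] by [q] is smaller than [f] and cannot lie in [P];
   primality leaves [q]. *)
have Pq : P q.
  have := q_dvd _ (PQ _ Pf) => e.
  have : P (f %/ q * q) by rewrite -e; exact: PM.
  case/Pprime => // Pd.
  have d0 : f %/ q != 0.
    apply/eqP => d0; move/eqP: e; rewrite d0 mul0r mulf_eq0 polyC_eq0.
    by rewrite (negPf (lc0 _)) (negPf f_neq0).
  have := f_min _ Pd d0; have := congr1 (size : {poly A} -> nat) e.
  rewrite size_Cmul // size_mul // => ->; rewrite leqNgt.
  by case: (size q) q_gt1 => [|[|m]] // _; rewrite !addnS ltnS leq_addr.
move=> g Qg; have : P ((lc g)%:P * g) by rewrite q_dvd //; exact: PM.
by case/Pprime => // /PQ /Qc /eqP; rewrite (negPf (lc0 _)).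
Qed.

(** * Evaluation and homogenization *)

Section Evaluation.
Variable R : realType.
Local Notation C := R[i].
Local Notation rc := (real_complex R).

Definition ev (K : comNzRingType) (N : nat) (x : 'rV[K]_N) (p : mpoly N K) : K :=
  meval (fun i => x 0 i) p.

Lemma cevalE N (p : mpoly N R) (x : 'rV[C]_N) : ceval p x = ev x (map_mpoly rc p).
Proof. by []. Qed.

Lemma ceval_sumE N (p : mpoly N R) (x : 'rV[C]_N) :
  ceval p x = \sum_(m <- msupp p) rc (mcoeff m p) * \prod_i x 0 i ^+ m i.
Proof.
rewrite /ceval [in LHS](mpolyE p) [map_mpoly _ _]raddf_sum [LHS]raddf_sum; apply: eq_bigr => m _ /=.
by rewrite map_mpolyZ mevalZ map_mpolyX mevalX.
Qed.

Lemma ceval_real N (p : mpoly N R) (x : 'rV[R]_N) :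
  ceval p (map_mx rc x) = rc (ev x p).
Proof.
rewrite ceval_sumE /ev mevalE rmorph_sum; apply: eq_bigr => m _.
rewrite rmorphM rmorph_prod; congr (_ * _); apply: eq_bigr => i _.
by rewrite rmorphXn mxE.
Qed.

Lemma ev_homog (K : comNzRingType) N d (p : mpoly N K) (a : K) (x : 'rV[K]_N) :
  p \is ishomog1 d mdeg -> ev (a *: x) p = a ^+ d * ev x p.
Proof.
move=> /dhomogP hp; rewrite /ev !mevalE mulr_sumr big_seq [RHS]big_seq.
apply: eq_bigr => m /hp /= md; rewrite mulrCA; congr (_ * _).
rewrite -md mdegE -prodrXr -big_split; apply: eq_bigr => i _ /=.
by rewrite mxE exprMn.
Qed.

Lemma map_mpoly_homog N d (p : mpoly N R) :
  p \is ishomog1 d mdeg -> map_mpoly rc p \is ishomog1 d mdeg.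
Proof.
move=> /dhomogP hp; apply/dhomogP => m; rewrite mcoeff_msupp mcoeff_map_mpoly => h.
by apply: hp; rewrite mcoeff_msupp; apply: contra h => /eqP ->; exact/eqP.
Qed.

(** The way back from complex polynomials, which translations by complex points introduce, to the
    real ones that define closed sets. At a real point both parts vanish when [G] does. *)
Lemma ev_re_im N (G : mpoly N C) (x : 'rV[C]_N) :
  ev x G = ceval (map_mpoly (@complex.Re R) G) x
         + 'i%C * ceval (map_mpoly (@complex.Im R) G) x.
Proof.
rewrite !cevalE /ev -mevalZ -mevalD; congr (meval _ _).
apply/mpolyP => m; rewrite mcoeffD mcoeffZ.
have mE (f : {additive C -> R}) :
    mcoeff m (map_mpoly rc (map_mpoly f G)) = rc (f (mcoeff m G)).
  by rewrite (mcoeff_map_mpoly rc) (mcoeff_map_mpoly f).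
apply: (etrans _ (esym (congr2 +%R (mE (@complex.Re R))
  (congr1 (fun w => 'i%C * w) (mE (@complex.Im R)))))) => /=.
by case: (mcoeff m G) => a b; simpc.
Qed.

Lemma translate_exists N (s : 'rV[C]_N) (G : mpoly N C) :
  {G' : mpoly N C | forall x, ev x G' = ev (x + s) G}.
Proof.
exists (comp_mpoly [tuple mpolyX C (mnm1 i) + mpolyC N (s 0 i) | i < N] G) => x.
rewrite /ev comp_mpoly_meval; apply: meval_eq => i.
by rewrite tnth_mktuple mevalD mevalXU mevalC mxE.
Qed.

(* Opaque, as unification would otherwise unfold [comp_mpoly]. *)
Definition translate N (s : 'rV[C]_N) (G : mpoly N C) : mpoly N C :=
  sval (translate_exists s G).

Lemma ev_translate N (s x : 'rV[C]_N) (G : mpoly N C) :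
  ev x (translate s G) = ev (x + s) G.
Proof. exact: (svalP (translate_exists s G)). Qed.

Section Homogenization.
Variable m : nat.

Lemma homog_coord0 (x : 'rV[C]_m) : homog_coord x 0 0 = 1.
Proof.
rewrite (_ : 0 = lshift m (0 : 'I_1)); last exact: val_inj.
by rewrite [LHS]row_mxEl mxE.
Qed.

Lemma homog_coordS (x : 'rV[C]_m) i : homog_coord x 0 (lift 0 i) = x 0 i.
Proof.
rewrite (_ : lift 0 i = rshift 1 i); last exact: val_inj.
by rewrite [LHS]row_mxEr.
Qed.

(** The degree is [msize p], one more than the degree of a nonzero [p], which leaves a spare factor
    [X_0]; it equals [1] at the points of the chart. *)
Definition homogenize (p : mpoly m R) : mpoly m.+1 R :=
  \sum_(mm <- msupp p) mcoeff mm p *: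
    (mpolyX R (mnm1 0) ^+ (msize p - mdeg mm) * \prod_i mpolyX R (mnm1 (lift 0 i)) ^+ mm i).

Lemma homogenize_homog p : homogenize p \is ishomog1 (msize p) mdeg.
Proof.
rewrite /homogenize big_seq; apply: rpred_sum => mm mp; apply: dhomogZ.
rewrite -[X in ishomog1 X](subnK (ltnW (msize_mdeg_lt mp))).
have X1 i : mpolyX R (mnm1 i) \is ishomog1 (n := m.+1) 1 mdeg.
  by rewrite dhomogX /= mdeg1.
apply: dhomogM; first by rewrite -[X in ishomog1 X]mul1n; exact: dhomogMn.
rewrite mdegE; elim/big_rec2: _ => [|i q d _ hq]; first exact: dhomog1.
by apply: dhomogM => //; rewrite -[X in ishomog1 X]mul1n; exact: dhomogMn.
Qed.

Lemma ceval_homogenize p (x : 'rV[C]_m) :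
  ceval (homogenize p) (homog_coord x) = ceval p x.
Proof.
rewrite [RHS]ceval_sumE /homogenize {1}/ceval [map_mpoly _ _]raddf_sum [LHS]raddf_sum; apply: eq_bigr => mm _ /=.
rewrite map_mpolyZ mevalZ rmorphM mevalM; congr (_ * _).
rewrite !rmorphXn /= map_mpolyX mevalXU homog_coord0 expr1n mul1r.
rewrite !rmorph_prod; apply: eq_bigr => i _.
by rewrite !rmorphXn /= map_mpolyX mevalXU homog_coordS.
Qed.

Definition dehomogenize (P : mpoly m.+1 R) : mpoly m R :=
  comp_mpoly [tuple oapp (fun j => mpolyX R (mnm1 j)) 1 (unlift 0 i) | i < m.+1] P.

Lemma ceval_dehomogenize P (x : 'rV[C]_m) :
  ceval (dehomogenize P) x = ceval P (homog_coord x).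
Proof.
rewrite [RHS]ceval_sumE /dehomogenize comp_mpolyE {1}/ceval [map_mpoly _ _]raddf_sum [LHS]raddf_sum.
apply: eq_bigr => mm _ /=; rewrite map_mpolyZ mevalZ; congr (_ * _).
rewrite !rmorph_prod; apply: eq_bigr => i _; rewrite !rmorphXn; congr (_ ^+ _).
rewrite tnth_mktuple; case: (unliftP 0 i) => [j|] -> /=.
  by rewrite map_mpolyX mevalXU homog_coordS.
by rewrite homog_coord0 !rmorph1.
Qed.

End Homogenization.
End Evaluation.

(** * Irreducible cones *)

Section OneVariable.
Variable R : realType.
Local Notation C := R[i].
Local Notation rc := (real_complex R).

(* With [e = circ] these are the trigonometric polynomials, with [e] the
   inclusion of the reals the polynomials. *)
Definition laurent_in (e : R -> C) (g : R -> C) :=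
  exists N (q : {poly C}), forall t, e t ^+ N * g t = q.[e t].

Variable e : R -> C.

Lemma laurent_cst a : laurent_in e (fun=> a).
Proof. by exists 0%N, a%:P => t; rewrite mul1r hornerC. Qed.

Lemma laurent_self : laurent_in e e.
Proof. by exists 0%N, 'X => t; rewrite mul1r hornerX. Qed.

Lemma laurentD g1 g2 : laurent_in e g1 -> laurent_in e g2 ->
  laurent_in e (fun t => g1 t + g2 t).
Proof.
move=> [N1 [q1 h1]] [N2 [q2 h2]]; exists (N1 + N2)%N, ('X^N2 * q1 + 'X^N1 * q2) => t.
by rewrite hornerD !hornerM !hornerXn -h1 -h2 exprD; ring.
Qed.

Lemma laurentM g1 g2 : laurent_in e g1 -> laurent_in e g2 ->
  laurent_in e (fun t => g1 t * g2 t).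
Proof.
move=> [N1 [q1 h1]] [N2 [q2 h2]]; exists (N1 + N2)%N, (q1 * q2) => t.
by rewrite hornerM -h1 -h2 exprD; ring.
Qed.

Lemma laurent_sum I (r : seq I) (F : I -> R -> C) :
  (forall i, laurent_in e (F i)) -> laurent_in e (fun t => \sum_(i <- r) F i t).
Proof.
move=> hF; elim: r => [|i r IHr].
  by have [N [q h]] := laurent_cst 0; exists N, q => t; rewrite big_nil.
by have [N [q h]] := laurentD (hF i) IHr; exists N, q => t; rewrite big_cons.
Qed.

Lemma laurent_prod I (r : seq I) (F : I -> R -> C) :
  (forall i, laurent_in e (F i)) -> laurent_in e (fun t => \prod_(i <- r) F i t).
Proof.
move=> hF; elim: r => [|i r IHr].
  by have [N [q h]] := laurent_cst 1; exists N, q => t; rewrite big_nil.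
by have [N [q h]] := laurentM (hF i) IHr; exists N, q => t; rewrite big_cons.
Qed.

Lemma laurentX g m : laurent_in e g -> laurent_in e (fun t => g t ^+ m).
Proof.
by move=> [N [q h]]; exists (N * m)%N, (q ^+ m) => t; rewrite horner_exp -h exprMn exprM.
Qed.

Lemma laurent_ev m (gamma : R -> 'rV[C]_m) (G : mpoly m C) :
  (forall i, laurent_in e (fun t => gamma t 0 i)) ->
  laurent_in e (fun t => ev (gamma t) G).
Proof.
move=> hg; apply: laurent_sum => mm; apply: laurentM; first exact: laurent_cst.
by apply: laurent_prod => i; apply: laurentX.
Qed.

(** The product of the two associated polynomials is nonzero and has finitely many roots, so an
    injective sequence of values of [e] leaves them. Points with [e t = 0] are excluded since there
    the relation need not determine [g]. *)
Lemma laurent_common_neq0 g1 g2 (s : nat -> R) :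
  laurent_in e g1 -> laurent_in e g2 -> injective (e \o s) ->
  (exists2 t, e t != 0 & g1 t != 0) -> (exists2 t, e t != 0 & g2 t != 0) ->
  exists j, g1 (s j) != 0 /\ g2 (s j) != 0.
Proof.
move=> [N1 [q1 h1]] [N2 [q2 h2]] s_inj [t1 et1 g1t] [t2 et2 g2t].
have q10 : q1 != 0.
  apply: contraNneq (mulf_neq0 (expf_neq0 N1 et1) g1t) => q0.
  by rewrite h1 q0 horner0.
have q20 : q2 != 0.
  apply: contraNneq (mulf_neq0 (expf_neq0 N2 et2) g2t) => q0.
  by rewrite h2 q0 horner0.
have q0 : q1 * q2 != 0 by rewrite mulf_neq0.
pose rs := [seq e (s j) | j <- iota 0 (size (q1 * q2)%R)].
have : ~~ all (root (q1 * q2)) rs.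
  apply/negP => rs_root; have := max_poly_roots q0 rs_root.
  by rewrite map_inj_uniq // iota_uniq size_map size_iota ltnn => /(_ isT).
case/allPn => _ /mapP[j _ ->]; rewrite rootE hornerM -h1 -h2 !mulf_eq0 !negb_or.
by case/andP => /andP[_ ?] /andP[_ ?]; exists j.
Qed.

Lemma laurent_eq0 g (s : nat -> R) : laurent_in e g -> injective (e \o s) ->
  (forall j, g (s j) = 0) -> forall t, e t != 0 -> g t = 0.
Proof.
move=> hg s_inj g0 t et; apply/eqP/negPn/negP => gt.
have [||j []] := laurent_common_neq0 hg hg s_inj; [by exists t|by exists t|].
by rewrite g0 eqxx.
Qed.

End OneVariable.

(** * Cones over arcs and their sums *)

Section Cones.
Variable R : realType.
Local Notation C := R[i].
Local Notation rc := (real_complex R).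

(** Complex polynomials are allowed because the induction over the summands translates them by
    complex points. *)
Definition cone_irreducible N (S : set 'rV[C]_N) :=
  forall F G : mpoly N C, (forall x, S x -> ev x F * ev x G = 0) ->
    (forall x, S x -> ev x F = 0) \/ (forall x, S x -> ev x G = 0).

(** For cones over arcs of the curve, the sums with one term from each form the cone over the join
    of the arcs. *)
Definition minkowski N (m : nat) (S : nat -> set 'rV[C]_N) : set 'rV[C]_N :=
  [set x | exists2 v, (forall i, (i < m)%N -> S i (v i)) & x = \sum_(i < m) v i].

Lemma minkowski0 N (S : nat -> set 'rV[C]_N) : minkowski 0 S = [set 0].
Proof.
apply/seteqP; split=> x /=; first by move=> [v _ ->]; rewrite big_ord0.
by move=> ->; exists (fun=> 0) => //; rewrite big_ord0.
Qed.

Lemma minkowskiS N m (S : nat -> set 'rV[C]_N) x y :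
  minkowski m S x -> S m y -> minkowski m.+1 S (x + y).
Proof.
move=> [v Sv ->] Sy; exists (fun i => if i == m then y else v i).
  move=> i; rewrite ltnS leq_eqVlt => /orP[/eqP ->|im]; first by rewrite eqxx.
  by rewrite ltn_eqF //; exact: Sv.
rewrite big_ord_recr /= eqxx; congr (_ + _); apply: eq_bigr => i _.
by rewrite ltn_eqF.
Qed.

Lemma minkowskiP N m (S : nat -> set 'rV[C]_N) z :
  minkowski m.+1 S z -> exists x y, [/\ minkowski m S x, S m y & z = x + y].
Proof.
move=> [v Sv ->]; exists (\sum_(i < m) v i), (v m); split.
- by exists v => // i im; apply: Sv; rewrite ltnS ltnW.
- exact: Sv.
- by rewrite big_ord_recr.
Qed.

(** The argument for a product of irreducible sets. For each [x] in the partial sum, [F(x + .)] or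
    [G(x + .)] vanishes on the last summand. If [F] and [G] are nonzero at [x1 + y1] and [x2 + y2],
    the product of [F(. + y1)] and [G(. + y2)] vanishes on the partial sum with neither factor
    vanishing there. *)
Lemma minkowski_irreducible N m (S : nat -> set 'rV[C]_N) :
  (forall i, (i < m)%N -> cone_irreducible (S i)) -> cone_irreducible (minkowski m S).
Proof.
elim: m => [|m IHm] irrS.
  rewrite minkowski0 => F G FG; have /eqP := FG 0 erefl.
  by rewrite mulf_eq0 => /orP[] /eqP h; [left|right] => x ->.
have {}IHm : cone_irreducible (minkowski m S).
  by apply: IHm => i im; apply: irrS; rewrite ltnS ltnW.
have irrm := irrS m (ltnSn m).
move=> F G FG; apply: contrapT => /not_orP[].
move=> /existsNP[z1 /not_implyP[/minkowskiP[x1 [y1 [Sx1 Sy1 ->]]] Fz]].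
move=> /existsNP[z2 /not_implyP[/minkowskiP[x2 [y2 [Sx2 Sy2 ->]]] Gz]].
have FGx x : minkowski m S x ->
    (forall y, S m y -> ev y (translate x F) = 0) \/
    (forall y, S m y -> ev y (translate x G) = 0).
  move=> Sx; apply: (irrm (translate x F) (translate x G)) => y Sy.
  by rewrite !ev_translate [y + x]addrC (FG _ (minkowskiS Sx Sy)).
have [x Sx||] := IHm (translate y1 F) (translate y2 G).
- rewrite !ev_translate; have [h|h] := FGx x Sx.
    by have := h _ Sy1; rewrite ev_translate addrC => ->; rewrite mul0r.
  by have := h _ Sy2; rewrite ev_translate addrC => ->; rewrite mulr0.
- by move=> /(_ _ Sx1); rewrite ev_translate.
- by move=> /(_ _ Sx2); rewrite ev_translate.
Qed.

Lemma minkowski_dense N m (S S' : nat -> set 'rV[C]_N) :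
  (forall i, (i < m)%N -> forall G : mpoly N C,
     (forall x, S i x -> ev x G = 0) -> forall x, S' i x -> ev x G = 0) ->
  forall G : mpoly N C, (forall x, minkowski m S x -> ev x G = 0) ->
  forall x, minkowski m S' x -> ev x G = 0.
Proof.
elim: m => [|m IHm] hS G G0 x; first by move: G0; rewrite !minkowski0; apply.
move=> /minkowskiP[y [z [Sy Sz ->]]]; rewrite -ev_translate.
move: y Sy; apply: IHm => [i im|y Sy].
  by apply: hS; rewrite ltnS ltnW.
rewrite ev_translate addrC -ev_translate.
apply: (hS m) (Sz) => // w Sw; rewrite ev_translate addrC.
by apply: G0; exact: minkowskiS.
Qed.

Variable n : nat.

Definition bn_vec (t : R) : 'rV[C]_n.+2 := homog_coord (map_mx rc (bn_point n t)).

Lemma rc_cos (t : R) : 2 * rc (cos t) = circ t + circ (- t).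
Proof.
rewrite /circ cosN sinN; have -> : (2 : C) = rc 2 by rewrite rmorph_nat.
by simpc; congr (_ +i* _)%C; ring.
Qed.

Lemma laurent_circMn (j : nat) : laurent_in (@circ R) (fun t => circ (j%:R * t)).
Proof. by exists 0%N, 'X^j => t; rewrite mul1r hornerXn circMn. Qed.

Lemma laurent_circMNn (j : nat) : laurent_in (@circ R) (fun t => circ (- (j%:R * t))).
Proof.
exists j, 1 => t; rewrite hornerC -circMn -circD subrr circ0 //.
Qed.

Lemma laurent_bn_vec i : laurent_in (@circ R) (fun t => bn_vec t 0 i).
Proof.
case: (unliftP 0 i) => [j|] ->; last first.
  rewrite (_ : (fun t => _) = (fun=> 1)); first exact: laurent_cst.
  by apply/funext => t; rewrite homog_coord0.
rewrite (_ : (fun t => _) = (fun t => rc (bn_point n t 0 j))); last first.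
  by apply/funext => t; rewrite homog_coordS mxE.
case oj : (odd j).
  rewrite (_ : (fun t => _) = (fun t => (2 * 'i%C)^-1 *
      (circ (j%:R * t) + (-1) * circ (- (j%:R * t))))); last first.
    apply/funext => t; rewrite mulN1r circ_subN mxE oj mulKf //.
    by rewrite mulf_neq0 ?pnatr_eq0 // complexi_neq0.
  apply: laurentM; first exact: laurent_cst.
  apply: laurentD; first exact: laurent_circMn.
  by apply: laurentM; [exact: laurent_cst|exact: laurent_circMNn].
rewrite (_ : (fun t => _) = (fun t => 2^-1 *
    (circ (j.+1%:R * t) + circ (- (j.+1%:R * t))))); last first.
  by apply/funext => t; rewrite -rc_cos mxE oj mulKf // pnatr_eq0.
apply: laurentM; first exact: laurent_cst.
by apply: laurentD; [exact: laurent_circMn|exact: laurent_circMNn].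
Qed.

Lemma laurent_ev_bn (G : mpoly n.+2 C) (a : C) :
  laurent_in (@circ R) (fun t => ev (a *: bn_vec t) G).
Proof.
apply: laurent_ev => i.
rewrite (_ : (fun t => _) = (fun t => a * bn_vec t 0 i)).
  by apply: laurentM; [exact: laurent_cst|exact: laurent_bn_vec].
by apply/funext => t; rewrite mxE.
Qed.

Lemma laurent_ev_scale N (G : mpoly N C) (v : 'rV[C]_N) :
  laurent_in rc (fun a => ev (rc a *: v) G).
Proof.
apply: laurent_ev => i.
rewrite (_ : (fun t => _) = (fun t => rc t * v 0 i)).
  by apply: laurentM; [exact: laurent_self|exact: laurent_cst].
by apply/funext => t; rewrite mxE.
Qed.

Definition arc_seq (a b : R) (j : nat) : R := a + (b - a) / j.+2%:R.

Lemma arc_seq_in a b j : a < b -> a < arc_seq a b j < b.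
Proof.
move=> ab; rewrite /arc_seq ltrDl divr_gt0 ?subr_gt0 // -ltrBrDl.
by rewrite ltr_pdivrMr // ltr_pMr ?subr_gt0 // ltr1n.
Qed.

Lemma circ_arc_seq_inj a b : a < b -> b - a < pi -> injective (@circ R \o arc_seq a b).
Proof.
move=> ab bapi i j /= /(congr1 (fun z => z ^+ 2)) /circ_sq_inj h.
have : arc_seq a b i = arc_seq a b j.
  by apply: h; have := arc_seq_in i ab; have := arc_seq_in j ab; rewrite ltr_norml; lra.
move=> /addrI /mulfI; rewrite subr_eq0 gt_eqF // => /(_ isT) /invr_inj /eqP.
by rewrite eqr_nat => /eqP[].
Qed.

Lemma rc_inj : injective rc.
Proof. by move=> x y []. Qed.

Lemma rc_nat_inj : injective (rc \o (fun j : nat => j.+1%:R)).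
Proof. by move=> i j /rc_inj/eqP; rewrite eqr_nat => /eqP[]. Qed.

Definition arc_cone (a b : R) : set 'rV[C]_n.+2 :=
  [set x | exists l t, [/\ 0 < l, a < t < b & x = rc l *: bn_vec t]].

(** A one-variable argument used twice: with the two scales fixed, a common angle at which neither
    polynomial vanishes; then, with that angle fixed, a common scale. *)
Lemma arc_cone_irreducible a b : a < b -> b - a < pi -> cone_irreducible (arc_cone a b).
Proof.
move=> ab bapi F G FG; apply: contrapT => /not_orP[].
move=> /existsNP[_ /not_implyP[[l1 [t1 [l1_gt0 t1ab ->]]] /eqP Fz]].
move=> /existsNP[_ /not_implyP[[l2 [t2 [l2_gt0 t2ab ->]]] /eqP Gz]].
have [||j [Fj Gj]] := laurent_common_neq0 (laurent_ev_bn F (rc l1))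
    (laurent_ev_bn G (rc l2)) (circ_arc_seq_inj ab bapi).
- exact: (ex_intro2 _ _ t1 (circ_neq0 t1) Fz).
- exact: (ex_intro2 _ _ t2 (circ_neq0 t2) Gz).
set t := arc_seq a b j in Fj Gj.
have rc_neq0 l : 0 < l -> rc l != 0.
  by move=> l0; apply/eqP => /rc_inj /eqP; rewrite gt_eqF.
have [||i [Fi Gi]] := laurent_common_neq0 (laurent_ev_scale F (bn_vec t))
    (laurent_ev_scale G (bn_vec t)) rc_nat_inj.
- exact: (ex_intro2 _ _ l1 (rc_neq0 _ l1_gt0) Fj).
- exact: (ex_intro2 _ _ l2 (rc_neq0 _ l2_gt0) Gj).
move/eqP: (mulf_neq0 Fi Gi); apply; apply: FG.
by exists i.+1%:R, t; split=> //; exact: arc_seq_in.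
Qed.

End Cones.

(** * The secant variety *)

Section SecantVariety.
Variables (R : realType) (k : nat).
Local Notation C := R[i].
Local Notation rc := (real_complex R).
Local Notation n := (k.*2.+1).
Local Notation c := (bn_point n).

Lemma zariski_closed_zeros m (p : mpoly m R) :
  zariski_closed [set x : 'rV[C]_m | ceval p x = 0].
Proof.
exists [set p]; apply/seteqP; split=> x /=; first by move=> px q ->.
by move=> /(_ p erefl).
Qed.

Lemma ceval_scale_homog m d (p : mpoly m R) (a : C) (x : 'rV[C]_m) :
  p \is ishomog1 d mdeg -> ceval p (a *: x) = a ^+ d * ceval p x.
Proof. by move=> hp; rewrite !cevalE (ev_homog _ _ (map_mpoly_homog hp)). Qed.

Lemma ceval_pihomog m (p : mpoly m R) (a : C) (x : 'rV[C]_m) :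
  ceval p (a *: x) = \sum_(d < msize p) a ^+ d * ceval (pihomog mdeg d p) x.
Proof.
rewrite [in LHS](pihomog_partitionE (leqnn (msize p))).
rewrite {1}/ceval [map_mpoly _ _]raddf_sum [LHS]raddf_sum; apply: eq_bigr => d _ /=.
by rewrite -ceval_scale_homog // pihomogP.
Qed.

Lemma proj_chart_zeros m d (P : mpoly m.+1 R) (x : 'rV[C]_m) :
  P \is ishomog1 d mdeg -> ceval P (homog_coord x) = 0 ->
  forall v, v \in proj_line (proj_chart x) -> ceval P v = 0.
Proof.
by move=> hP Px v /vlineP[a ->]; rewrite (ceval_scale_homog _ _ hP) Px mulr0.
Qed.

(** Only real homogeneous equations pass to the projective closure. So [G] is split into real and
    imaginary parts, which vanish separately because the cone consists of real points, and these
    into homogeneous components, which vanish separately because the cone is stable under positive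
    scaling. *)
Lemma proj_curve_zeros (a b : R) (G : mpoly n.+2 C) : a < b -> b - a < pi ->
  (forall x, @arc_cone R n a b x -> ev x G = 0) ->
  forall (L : proj_point R n.+1) v, bn_proj_curve R n L -> v \in proj_line L -> ev v G = 0.
Proof.
move=> ab bapi.
suff real_case (p : mpoly n.+2 R) : (forall x, @arc_cone R n a b x -> ceval p x = 0) ->
    forall (L : proj_point R n.+1) v, bn_proj_curve R n L -> v \in proj_line L -> ceval p v = 0.
  move=> G0 L v XL Lv.
  have parts x : @arc_cone R n a b x -> ceval (map_mpoly (@complex.Re R) G) x = 0 /\
      ceval (map_mpoly (@complex.Im R) G) x = 0.
    move=> Sx; have := G0 _ Sx; rewrite ev_re_im.
    have [y ->] : exists y, x = map_mx rc y.
      case: Sx => l [t [_ _ ->]].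
      exists (\row_i (if unlift 0 i is Some j then l * c t 0 j else l)).
      apply/rowP => i; rewrite [LHS]mxE [RHS]mxE [in RHS]mxE.
      case: (unliftP 0 i) => [j|] -> /=; first by rewrite homog_coordS [in LHS]mxE rmorphM.
      by rewrite homog_coord0 mulr1.
    by rewrite !ceval_real; simpc => -[-> ->].
  rewrite ev_re_im !(real_case _ _ L v XL Lv) ?mulr0 ?addr0 //.
    by move=> x /parts[].
  by move=> x /parts[].
move=> p0 L v XL Lv; rewrite -[v]scale1r ceval_pihomog big1 // => d _.
set q := pihomog mdeg d p; have hq : q \is ishomog1 d mdeg by exact: pihomogP.
have q_arc t : a < t < b -> ceval q (bn_vec n t) = 0.
  move=> tab.
  (* The restriction of [p] to the line through [bn_vec n t]; its coefficients are the values of the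
     homogeneous components, and it vanishes at all positive integers. *)
  pose Q : {poly C} := \poly_(e < msize p) ceval (pihomog mdeg e p) (bn_vec n t).
  have Qeval (x : C) : Q.[x] = ceval p (x *: bn_vec n t).
    by rewrite horner_poly ceval_pihomog; apply: eq_bigr => e _; rewrite mulrC.
  have Q0 : Q = 0.
    apply/eqP/negPn/negP => Q_neq0.
    pose rs := [seq (rc j.+1%:R) | j <- iota 0 (size Q)].
    have := max_poly_roots Q_neq0 (rs := rs).
    rewrite map_inj_uniq ?iota_uniq; last exact: rc_nat_inj.
    rewrite size_map size_iota ltnn => h; suff : all (root Q) rs by move=> /h /(_ isT).
    apply/allP => _ /mapP[j _ ->]; apply/rootP; rewrite Qeval; apply: p0.
    by exists j.+1%:R, t.
  by have := coef_poly (msize p) (fun e => ceval (pihomog mdeg e p) (bn_vec n t)) d;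
     rewrite -/Q Q0 coef0 ltn_ord.
have q_all t : ceval q (bn_vec n t) = 0.
  rewrite -[bn_vec n t]scale1r.
  have h := laurent_ev_bn (n := n) (map_mpoly rc q) 1.
  apply: (laurent_eq0 h (circ_arc_seq_inj ab bapi)); last exact: circ_neq0.
  by move=> j; rewrite scale1r; apply: q_arc; exact: arc_seq_in.
have qX x : bn_curve R n x -> ceval (dehomogenize q) x = 0.
  apply: (@smallest_sub _ _ _ [set x | ceval (dehomogenize q) x = 0]).
    exact: zariski_closed_zeros.
  by move=> _ [_ [t _ <-] <-] /=; rewrite ceval_dehomogenize; exact: q_all.
rewrite expr1n mul1r; move: v Lv; apply: (@smallest_sub _ _ _
    [set L : proj_point R n.+1 | forall v, v \in proj_line L -> ceval q v = 0] _ _ L XL).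
  exists [set q] => [_ ->|]; first by exists d.
  by apply/seteqP; split=> K /= h; [move=> _ ->|exact: h].
move=> _ [x Xx <-] /= v; apply: (proj_chart_zeros hq).
by rewrite -ceval_dehomogenize qX.
Qed.

(** Endpoints of [k + 1] equal subintervals of [[0, pi/4]]. One parameter in the interior of each
    makes the points distinct and ordered, with no condition linking the parameters. *)
Definition arc_end (i : nat) : R := i%:R * (pi / 4 / k.+1%:R).

Lemma arc_end_lt i j : (i < j)%N -> arc_end i < arc_end j.
Proof. by move=> ij; rewrite ltr_pM2r ?ltr_nat // !divr_gt0 ?ltr0n // pi_gt0. Qed.

Lemma arc_end0 : arc_end 0 = 0.
Proof. by rewrite /arc_end mul0r. Qed.

Lemma arc_endS : arc_end k.+1 = pi / 4.
Proof. by rewrite /arc_end mulrC divfK // pnatr_eq0. Qed.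

Lemma arc_end_le i j : (i <= j)%N -> arc_end i <= arc_end j.
Proof. by rewrite leq_eqVlt => /orP[/eqP -> //|/arc_end_lt/ltW]. Qed.

Definition in_arcs (t : nat -> R) :=
  forall i, (i <= k)%N -> arc_end i < t i < arc_end i.+1.

Definition open_secants : set 'rV[R]_n.+1 :=
  [set x | exists l t, [/\ forall i, (i <= k)%N -> 0 < l i, in_arcs t,
     \sum_(i < k.+1) l i = 1 & x = \sum_(i < k.+1) l i *: c (t i)]].

Local Notation S i := (@arc_cone R n (arc_end i) (arc_end i.+1)).

Lemma homog_coord_sum (l : nat -> R) (y : nat -> 'rV[R]_n.+1) (tau : R) :
  tau != 0 -> \sum_(i < k.+1) l i = tau ->
  \sum_(i < k.+1) rc (l i) *: homog_coord (map_mx rc (y i)) =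
  rc tau *: homog_coord (map_mx rc (\sum_(i < k.+1) (l i / tau) *: y i)).
Proof.
move=> tau0 ltau; apply/rowP => j; rewrite summxE [RHS]mxE.
case: (unliftP 0 j) => [j'|] ->; last first.
  rewrite homog_coord0 mulr1 -ltau rmorph_sum; apply: eq_bigr => i _.
  by rewrite mxE homog_coord0 mulr1.
rewrite homog_coordS mxE summxE rmorph_sum mulr_sumr; apply: eq_bigr => i _.
rewrite mxE homog_coordS !mxE !rmorphM fmorphV /=.
have : rc tau != 0 by rewrite fmorph_eq0.
by move: (rc tau) (rc (l i)) => u v u0; field.
Qed.

Lemma cone_open_secants x : minkowski k.+1 (fun i => S i) x ->
  exists tau y, [/\ 0 < tau, open_secants y & x = rc tau *: homog_coord (map_mx rc y)].
Proof.
move=> [v Sv ->].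
have /choice[lt ltP] : forall i, exists lt : R * R, (i < k.+1)%N ->
    [/\ 0 < lt.1, arc_end i < lt.2 < arc_end i.+1 & v i = rc lt.1 *: bn_vec n lt.2].
  move=> i; have [ik|ik] := ltnP i k.+1; last by exists (0, 0).
  by have [l [t h]] := Sv i ik; exists (l, t).
pose tau := \sum_(i < k.+1) (lt i).1.
have tau0 : 0 < tau.
  rewrite /tau big_ord_recr /= ltr_wpDl //; last by have [] := ltP k (ltnSn k).
  by apply: sumr_ge0 => i _; have [/ltW] := ltP i (ltnW (ltn_ord i)).
exists tau, (\sum_(i < k.+1) ((lt i).1 / tau) *: c (lt i).2); split=> //.
  exists (fun i => (lt i).1 / tau), (fun i => (lt i).2); split=> //.
  - by move=> i ik; have [l0 _ _] := ltP i ik; rewrite divr_gt0.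
  - by move=> i ik; have [_ ? _] := ltP i ik.
  - by rewrite -mulr_suml divff // gt_eqF.
have tau_neq0 : tau != 0 by rewrite gt_eqF.
have /= <- := @homog_coord_sum (fun i => (lt i).1) (fun i => c (lt i).2) _ tau_neq0 erefl.
by apply: eq_bigr => i _; have [_ _ ->] := ltP i (ltn_ord i).
Qed.

Lemma open_secants_cone (l t : nat -> R) :
  (forall i, (i <= k)%N -> 0 < l i) -> in_arcs t ->
  minkowski k.+1 (fun i => S i) (\sum_(i < k.+1) rc (l i) *: bn_vec n (t i)).
Proof.
move=> l0 tP; exists (fun i => rc (l i) *: bn_vec n (t i)) => // i ik.
by exists (l i), (t i); split; [exact: l0|exact: tP|].
Qed.

Lemma homogenize_cone (p : mpoly n.+1 R) :
  (forall y, open_secants y -> ceval p (map_mx rc y) = 0) ->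
  forall x, minkowski k.+1 (fun i => S i) x -> ceval (homogenize p) x = 0.
Proof.
move=> p0 x /cone_open_secants[tau [y [tau0 Ty ->]]].
by rewrite (ceval_scale_homog _ _ (homogenize_homog p)) ceval_homogenize p0 // mulr0.
Qed.

(** A vector on a secant plane is a sum of [k + 1] vectors on lines of the projective curve.
    Vanishing is carried from arcs to the whole curve in each summand by [minkowski_dense] and
    [proj_curve_zeros]; the homogeneous equation then passes to the closure. *)
Lemma secant_variety_zeros (p : mpoly n.+1 R) :
  (forall y, open_secants y -> ceval p (map_mx rc y) = 0) ->
  forall x, affine_part (secant_variety k (bn_proj_curve R n)) x -> ceval p x = 0.
Proof.
move=> p0 x; rewrite -ceval_homogenize.
set P := homogenize p; have hP : P \is ishomog1 (msize p) mdeg := homogenize_homog p.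
suff : secant_variety k (bn_proj_curve R n) `<=`
    [set L | forall v, v \in proj_line L -> ceval P v = 0].
  by move=> h /h; apply; rewrite memv_line.
apply: smallest_sub.
  exists [set P] => [_ ->|]; first by exists (msize p).
  by apply/seteqP; split=> K /= h; [move=> _ ->|exact: h].
move=> L [W [_ [Ls XL WE]] LW] v Lv /=.
have /memv_sumP[w wP ->] : v \in (\sum_i proj_line (Ls i))%VS.
  by rewrite -WE; apply: (subvP LW).
rewrite cevalE; pose S' := [set v : 'rV[C]_n.+2 |
  exists2 L, bn_proj_curve R n L & v \in proj_line L].
apply: (@minkowski_dense _ _ _ (fun i => S i) (fun=> S')); first last.
- exists (fun i => w (inord i)); last by apply: eq_bigr => i _; rewrite inord_val.
  by move=> i ik; exists (Ls (inord i)); [exact: XL|exact: wP].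
- exact: homogenize_cone.
move=> i ik G G0 y [L' XL' L'y].
apply: (@proj_curve_zeros (arc_end i) (arc_end i.+1) G _ _ G0 L') => //.
  exact: arc_end_lt.
have := @arc_end_le 0 i isT; have := @arc_end_le i.+1 k.+1 ik.
by rewrite arc_end0 arc_endS; have := pi_gt0 R; lra.
Qed.

Lemma arcs_incr (t : nat -> R) : in_arcs t -> forall i j, (i < j <= k)%N -> t i < t j.
Proof.
move=> tP i j /andP[ij jk].
have /andP[_ ti] := tP i (leq_trans (ltnW ij) jk); have /andP[tj _] := tP j jk.
by apply: (lt_le_trans ti); apply: le_trans (ltW tj); exact: arc_end_le.
Qed.

Lemma arcs_bound (t : nat -> R) i : in_arcs t -> (i <= k)%N -> 0 < t i < pi / 4.
Proof.
move=> tP ik; have := tP i ik; have := @arc_end_le 0 i isT.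
by have := @arc_end_le i.+1 k.+1 ik; rewrite arc_end0 arc_endS; lra.
Qed.

Lemma arcs_circ_neq (t : nat -> R) i j : in_arcs t -> (i <= k)%N -> (j <= k)%N ->
  i != j -> circ (t i) ^+ 2 != circ (t j) ^+ 2.
Proof.
move=> tP ik jk; apply: contra => /eqP /circ_sq_inj tij.
have := arcs_bound tP ik; have := arcs_bound tP jk => bj bi.
have {}tij : t i = t j by apply: tij; rewrite ltr_norml; have := pi_gt0 R; lra.
rewrite eqn_leq leqNgt [in X in _ && X]leqNgt; apply/andP; split; apply/negP => ij.
  by have := @arcs_incr t tP j i; rewrite ij ik tij ltxx => /(_ isT).
by have := @arcs_incr t tP i j; rewrite ij jk tij ltxx => /(_ isT).
Qed.

(** The [k + 1] tangencies and the [k] zeros away from [i0] (indexed through [bump i0]) are [n]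
    conditions on [n + 1] unknowns. A nonzero solution that also vanished at [t i0] would have
    [k + 1] double zeros. *)
Lemma interpolating_functional (t : nat -> R) (i0 : nat) : in_arcs t -> (i0 <= k)%N ->
  exists u, dotr u (c (t i0)) != 0 /\
    forall i, (i <= k)%N -> i != i0 -> dotr u (c (t i)) = 0.
Proof.
move=> tP i0k.
pose g (j : 'I_n) (u : 'rV[R]_n.+1) := if odd j then dotr u (c (t (bump i0 j./2)))
  else dotr (dcoef u) (c (t j./2)).
have [|u u0 gu] := @common_kernel _ _ g.
  move=> j a x y; rewrite /g; case: ifP => _; first by rewrite dotrDl.
  by rewrite dcoefD dotrDl.
have ut i : (i <= k)%N -> i != i0 -> dotr u (c (t i)) = 0.
  move=> ik ii0; pose j := unbump i0 i.
  have ij : bump i0 j = i by rewrite unbumpK // inE.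
  have jk : (j.*2.+1 < n)%N.
    rewrite ltnS ltn_double /j /unbump; case: (ltnP i0 i) => h /=; first by lia.
    by move/eqP: ii0; lia.
  by have := gu (Ordinal jk); rewrite /g /= odd_double /= uphalf_double ij.
exists u; split=> //; apply: contra u0 => /eqP ut0; apply/eqP.
apply: (@double_zeros_eq0 _ _ u (fun i : 'I_k.+1 => t i)).
- by move=> i j ij; apply: arcs_circ_neq => //; rewrite -ltnS.
- move=> i; have [->//|ii0] := eqVneq (i : nat) i0.
  by apply: ut; rewrite // -ltnS.
- move=> i; have ik : (i.*2 < n)%N by rewrite ltnS leq_double -ltnS.
  by have := gu (Ordinal ik); rewrite /g /= odd_double doubleK.
Qed.

(** Each coefficient of a relation is isolated by an interpolating functional. A secant plane must
    have full dimension, so this independence is what makes the chosen points span one. *)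
Lemma bn_vec_free (t : nat -> R) : in_arcs t ->
  free [tuple bn_vec n (t i) | i < k.+1].
Proof.
move=> tP; apply/freeP => a a0 i0.
have i0k : (i0 <= k)%N by rewrite -ltnS.
have [u [ut0 ut]] := interpolating_functional tP i0k.
have : \sum_(i < k.+1) a i * rc (dotr u (c (t i))) = 0.
  have e0 : \sum_(j < n.+1) rc (u 0 j) *
      (\sum_(i < k.+1) a i *: [tuple bn_vec n (t i) | i < k.+1]`_i) 0 (lift 0 j) = 0.
    by rewrite a0 big1 // => j _; rewrite mxE mulr0.
  rewrite -[RHS]e0; under [RHS]eq_bigr => j _ do rewrite summxE mulr_sumr.
  rewrite [RHS]exchange_big /=; apply: eq_bigr => i _.
  rewrite rmorph_sum mulr_sumr; apply: eq_bigr => j _.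
  rewrite (nth_map i) ?size_enum_ord // nth_ord_enum.
  by rewrite rmorphM [in RHS]mxE homog_coordS [in RHS]mxE mulrCA.
rewrite (bigD1 i0) //= big1 ?addr0 => [/eqP|i ii0].
  by rewrite mulf_eq0 fmorph_eq0 (negPf ut0) orbF => /eqP.
by rewrite ut ?rmorph0 ?mulr0 // -ltnS.
Qed.

Lemma open_secants_sub y : open_secants y ->
  affine_part (secant_variety k (bn_proj_curve R n)) (map_mx rc y).
Proof.
move=> [l [t [l0 tP l1 yE]]]; apply: sub_gen_smallest.
pose Ls (i : 'I_k.+1) := proj_chart (map_mx rc (c (t i))).
have WE : (\sum_i proj_line (Ls i) = <<[tuple bn_vec n (t i) | i < k.+1]>>)%VS.
  rewrite span_def big_tuple; apply: eq_bigr => i _.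
  by rewrite tnth_mktuple.
exists (\sum_i proj_line (Ls i))%VS; first split.
- by rewrite WE; have := bn_vec_free tP; rewrite /free size_tuple => /eqP.
- exists Ls => // i; apply: sub_gen_smallest.
  exists (map_mx rc (c (t i))) => //.
  apply: sub_gen_smallest.
  exists (c (t i)) => //; exists (t i) => //=.
  have ik : (i <= k)%N by rewrite -ltnS.
  by have := arcs_bound tP ik; have := pi_gt0 R; rewrite in_itv /=; lra.
rewrite -memvE /= (_ : homog_coord _ = \sum_(i < k.+1) rc (l i) *: bn_vec n (t i)).
  by apply: memv_sumr => i _; rewrite memvZ // memv_line.
rewrite (homog_coord_sum (fun i => c (t i)) _ l1) ?oner_neq0 // scale1r yE.
by congr (homog_coord (map_mx _ _)); apply: eq_bigr => i _; rewrite divr1.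
Qed.

(** From here on the secant variety is handled only as the Zariski closure of real points lying in
    explicit simplices. *)
Lemma affine_secant_varietyE :
  affine_part (secant_variety k (bn_proj_curve R n)) =
  [set x | forall p : mpoly n.+1 R,
     (forall y, open_secants y -> ceval p (map_mx rc y) = 0) -> ceval p x = 0].
Proof.
apply/seteqP; split=> x; first by move=> Sx p p0; exact: secant_variety_zeros p0 _ Sx.
move=> xP M [[Ps hPs ->] secM] P PsP; have [d hP] := hPs _ PsP.
apply: (proj_chart_zeros hP); rewrite -ceval_dehomogenize; apply: xP => y Ty.
rewrite ceval_dehomogenize.
have /= := @smallest_sub _ _ _ [set L | forall p, Ps p ->
           forall v : 'rV[R[i]]_n.+2, v \in proj_line L -> ceval p v = 0] _ secM _
   (open_secants_sub Ty).
by apply=> //; [exists Ps|rewrite memv_line].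
Qed.

End SecantVariety.

(** * The tangent argument *)

Section Terracini.
Variables (R : realType) (k : nat).
Local Notation n := (k.*2.+1).
Local Notation c := (bn_point n).

Lemma mpoly_ring_ind m (P : mpoly m R -> Prop) :
  (forall a, P (mpolyC m a)) -> (forall i, P (mpolyX R (mnm1 i))) ->
  (forall p q, P p -> P q -> P (p + q)) -> (forall p q, P p -> P q -> P (p * q)) ->
  forall p, P p.
Proof.
move=> PC PX PD PM; elim/mpolyind => [|a mm p _ _ Pp]; first by rewrite -mpolyC0.
apply: (PD _ _ _ Pp); rewrite -mul_mpolyC; apply: (PM _ _ (PC a)).
rewrite mpolyXE_id; elim/big_ind: _ => //; first exact: (PC 1).
move=> i _; elim: (mm i) => [|d IHd]; first exact: (PC 1).
by rewrite exprS; exact: PM.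
Qed.

Lemma is_derive_ev m (gamma : R -> 'rV[R]_m) (dgamma : 'I_m -> R) (s : R) (p : mpoly m R) :
  (forall j, is_derive s 1 (fun s => gamma s 0 j) (dgamma j)) ->
  is_derive s 1 (fun s => ev (gamma s) p) (\sum_j ev (gamma s) (mderiv j p) * dgamma j).
Proof.
move=> dg; elim/mpoly_ring_ind: p => [a|i|p q dp dq|p q dp dq].
- rewrite (_ : (fun s => _) = cst a); last by apply/funext => x; rewrite /ev mevalC.
  rewrite big1 => [|j _]; first exact: is_derive_cst.
  by rewrite mderivC /ev meval0 mul0r.
- rewrite (_ : (fun s => _) = (fun s => gamma s 0 i)); last first.
    by apply/funext => x; rewrite /ev mevalXU.
  rewrite (bigD1 i) //= big1 => [|j ji].
    rewrite mderivX mnm1E eqxx scale1r addr0.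
    rewrite (_ : mnm_sub _ _ = mnm0); last by apply/mnmP => j; rewrite mnmBE subnn mnm0E.
    by rewrite mpolyX0 /ev meval1 mul1r.
  by rewrite mderivX mnm1E eq_sym (negPf ji) scale0r /ev meval0 mul0r.
- rewrite (_ : (fun s => _) = (fun s => ev (gamma s) p) + (fun s => ev (gamma s) q)).
    apply: is_derive_eq; rewrite -big_split; apply: eq_bigr => j _ /=.
    by rewrite mderivD /ev mevalD mulrDl.
  by apply/funext => x; rewrite /ev mevalD.
rewrite (_ : (fun s => _) = (fun s => ev (gamma s) p) * (fun s => ev (gamma s) q)).
  apply: is_derive_eq; rewrite !scaler_sumr -big_split; apply: eq_bigr => j _ /=.
  by rewrite mderivM /ev mevalD !mevalM /GRing.scale /=; ring.
by apply/funext => x; rewrite /ev mevalM.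
Qed.

Lemma derive_zero_near (f : R -> R) (s d : R) :
  is_derive s 1 f d -> (\forall x \near s, f x = 0) -> d = 0.
Proof.
move=> [_ <-] f0; rewrite (near_eq_derive (g := cst 0)) ?derive_cst //.
Qed.

Definition cone_point (l t : nat -> R) : 'rV[R]_n.+1 := \sum_(i < k.+1) l i *: c (t i).

Lemma dotr_delta m (v : 'rV[R]_m) (j : 'I_m) : dotr (delta_mx 0 j) v = v 0 j.
Proof.
rewrite /dotr (bigD1 j) //= big1 ?addr0 => [|i ij]; first by rewrite mxE !eqxx mul1r.
by rewrite mxE eqxx (negPf ij) mul0r.
Qed.

Lemma dotr_dcoef_sum (u v : 'rV[R]_n.+1) :
  dotr (dcoef u) v = \sum_j u 0 j * dotr (dcoef (delta_mx 0 j)) v.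
Proof.
rewrite [in LHS](row_sum_delta u).
have h0 : dotr (dcoef (0 : 'rV[R]_n.+1)) v = 0.
  have := dcoefD (-1) 0 (0 : 'rV[R]_n.+1); rewrite scaler0 addr0 scaleN1r addNr => ->.
  by rewrite /dotr big1 // => i _; rewrite mxE mul0r.
elim: (index_enum _) => [|j r IHr]; first by rewrite !big_nil.
by rewrite !big_cons dcoefD dotrDl IHr.
Qed.

Lemma is_derive_bn_coord (j : 'I_n.+1) (s : R) :
  is_derive s 1 (fun s => c s 0 j) (dotr (dcoef (delta_mx 0 j)) (c s)).
Proof.
rewrite (_ : (fun s => _) = (fun s => dotr (delta_mx 0 j) (c s))).
  exact: is_derive_bn.
by apply/funext => x; rewrite dotr_delta.
Qed.

Definition upd (f : nat -> R) (i : nat) (a : R) (j : nat) := if j == i then a else f j.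

Lemma cone_point_updl l t (i : nat) a : (i <= k)%N ->
  cone_point (upd l i a) t = cone_point l t + (a - l i) *: c (t i).
Proof.
move=> ik; have i_lt : (i < k.+1)%N by [].
rewrite /cone_point (bigD1 (Ordinal i_lt)) //= [in RHS](bigD1 (Ordinal i_lt)) //=.
rewrite /upd eqxx addrAC -scalerDl [l i + _]addrC subrK; congr (_ + _).
apply: eq_bigr => j /eqP ji; case: eqP => // e.
by case: ji; apply: val_inj.
Qed.

Lemma cone_point_updr l t (i : nat) a : (i <= k)%N ->
  cone_point l (upd t i a) = cone_point l t + l i *: (c a - c (t i)).
Proof.
move=> ik; have i_lt : (i < k.+1)%N by [].
rewrite /cone_point (bigD1 (Ordinal i_lt)) //= [in RHS](bigD1 (Ordinal i_lt)) //=.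
rewrite /upd eqxx addrAC -scalerDr [c (t i) + _]addrC subrK; congr (_ + _).
apply: eq_bigr => j /eqP ji; case: eqP => // e.
by case: ji; apply: val_inj.
Qed.

Local Notation cone_param l t :=
  ((forall i, (i <= k)%N -> 0 < l i) /\ in_arcs k t).

(* The differential of [cone_point] is onto, so a polynomial that vanishes on the
   cone over the secants vanishes there with its partial derivatives. *)
Lemma cone_mderiv (a : mpoly n.+1 R) :
  (forall l t, cone_param l t -> ev (cone_point l t) a = 0) ->
  forall j l t, cone_param l t -> ev (cone_point l t) (mderiv j a) = 0.
Proof.
move=> a0 j l t [l0 tP].
pose x := cone_point l t; pose G : 'rV[R]_n.+1 := \row_j ev x (mderiv j a).
suff /rowP/(_ j) : G = 0 by rewrite !mxE.
(* Varying the weight [l i] moves the point along [c (t i)], so the gradient [G] is orthogonal to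
   it. *)
have Gc i : (i <= k)%N -> dotr G (c (t i)) = 0.
  move=> ik; pose gamma s := cone_point (upd l i s) t.
  have gE : gamma (l i) = x by rewrite /gamma cone_point_updl // subrr scale0r addr0.
  have dg m : is_derive (l i) 1 (fun s => gamma s 0 m) (c (t i) 0 m).
    rewrite (_ : (fun s => _) = (fun s => x 0 m + (s - l i) * c (t i) 0 m)).
      by apply: is_derive_eq; rewrite /GRing.scale /=; ring.
    by apply/funext => s; rewrite /gamma cone_point_updl // !mxE.
  have := is_derive_ev a dg; rewrite gE => /derive_zero_near h.
  rewrite -[RHS]h /dotr; first by apply: eq_bigr => m _; rewrite mxE.
  apply: filterS (lt_nbhsr (l0 i ik)) => s s0; apply: a0; split=> // m mk.
  by rewrite /upd; case: eqP => // _; exact: l0.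
(* Varying the angle [t i], which may move because the subintervals are open, gives orthogonality to
   the tangent vector. Thus [G] has [k + 1] double zeros. *)
have Gdc i : (i <= k)%N -> dotr (dcoef G) (c (t i)) = 0.
  move=> ik; pose gamma s := cone_point l (upd t i s).
  have gE : gamma (t i) = x by rewrite /gamma cone_point_updr // subrr scaler0 addr0.
  have dg m : is_derive (t i) 1 (fun s => gamma s 0 m)
      (l i * dotr (dcoef (delta_mx 0 m)) (c (t i))).
    rewrite (_ : (fun s => _) = (fun s => x 0 m + l i * (c s 0 m - c (t i) 0 m))).
      have := is_derive_bn_coord m (t i) => ?.
      by apply: is_derive_eq; rewrite /GRing.scale /=; ring.
    by apply/funext => s; rewrite /gamma cone_point_updr // !mxE.
  have := is_derive_ev a dg; rewrite gE => /derive_zero_near h.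
  apply: (mulfI (lt0r_neq0 (l0 _ ik))); rewrite mulr0 -[RHS]h.
    rewrite dotr_dcoef_sum mulr_sumr; apply: eq_bigr => m _; rewrite mxE; ring.
  have /andP[t1 t2] := tP i ik.
  apply: filterS2 (lt_nbhsr t1) (lt_nbhsl t2) => s s1 s2; apply: a0; split=> // m mk.
  by rewrite /upd; case: eqP => [->|_]; [apply/andP|exact: tP].
apply: (@double_zeros_eq0 _ _ G (fun i : 'I_k.+1 => t i)).
- by move=> i i' ii'; exact: (arcs_circ_neq tP (ltn_ord i) (ltn_ord i') ii').
- by move=> i; exact: (Gc i (ltn_ord i)).
- by move=> i; exact: (Gdc i (ltn_ord i)).
Qed.

Lemma cone_point_exists : exists l t : nat -> R, cone_param l t.
Proof.
exists (fun=> 1), (fun i => (arc_end R k i + arc_end R k i.+1) / 2); split=> // i _.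
by have := arc_end_lt R k (ltnSn i); lra.
Qed.

(** Induction on a degree bound: the partial derivatives vanish on the cone too, hence are [0], so
    in characteristic zero [a] is a constant, and its value at one point of the cone is [0]. *)
Lemma cone_zariski_dense (a : mpoly n.+1 R) :
  (forall l t, cone_param l t -> ev (cone_point l t) a = 0) -> a = 0.
Proof.
have [D aD] : exists D, forall mm, (D <= mdeg mm)%N -> mcoeff mm a = 0.
  exists (msize a) => mm h; apply/eqP; rewrite mcoeff_eq0; apply/negP => /msize_mdeg_lt.
  by rewrite ltnNge h.
elim: D a aD => [|D IHD] a aD a0; first by apply/mpolyP => mm; rewrite aD // mcoeff0.
have da j : mderiv j a = 0.
  apply: IHD; last by move=> l t lt; exact: cone_mderiv.
  move=> mm h; rewrite mcoeff_deriv aD ?mul0rn //.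
  by rewrite mdegD mdeg1 addn1 ltnS.
have aE : a = mpolyC _ (mcoeff mnm0 a).
  apply/mpolyP => mm; rewrite mcoeffC; have [->|mm0] := eqVneq mm mnm0.
    by rewrite mulr1.
  rewrite mulr0; have [i mi] : exists i, mm i != 0%N.
    apply/existsP; rewrite -negb_forall; apply: contra mm0 => /forallP h.
    by apply/eqP/mnmP => i; rewrite mnm0E; apply/eqP.
  have := congr1 (mcoeff (mnm_sub mm (mnm1 i))) (da i); rewrite mcoeff_deriv mcoeff0.
  rewrite submK; last first.
    by apply/mnm_lepP => j; rewrite mnm1E; case: eqP => // <-; rewrite lt0n.
  by move/eqP; rewrite mulrn_eq0 => /eqP.
have [l [t lt]] := cone_point_exists.
by have := a0 l t lt; rewrite aE /ev mevalC => ->; rewrite mpolyC0.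
Qed.

End Terracini.

(** * Ideals of cones *)

Section ConeIdeal.
Variables (R : realType) (m : nat).
Local Notation C := R[i].
Local Notation rc := (real_complex R).
Local Notation A := (mpoly m R).
Implicit Types (F G : {poly A}) (z : 'rV[C]_m) (tau : R).

(* Value of [F] at the point [(tau z, tau)] of the cone over [z]. *)
Definition cone_eval z tau F : C :=
  \sum_(j < size F) ceval F`_j (rc tau *: z) * rc tau ^+ j.

Lemma cone_evalE z tau F : cone_eval z tau F =
  (map_poly (meval (fun i => (rc tau *: z) 0 i) \o map_mpoly rc) F).[rc tau].
Proof.
rewrite /cone_eval (@horner_coef_wide _ (size F)); last exact: size_poly.
by apply: eq_bigr => j _; rewrite coef_map.
Qed.

Lemma cone_evalM z tau F G : cone_eval z tau (F * G) = cone_eval z tau F * cone_eval z tau G.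
Proof. by rewrite !cone_evalE rmorphM hornerM. Qed.

Lemma cone_evalB z tau F G : cone_eval z tau (F - G) = cone_eval z tau F - cone_eval z tau G.
Proof. by rewrite !cone_evalE rmorphB hornerD hornerN. Qed.

Lemma cone_evalC z tau (a : A) : cone_eval z tau a%:P = ceval a (rc tau *: z).
Proof. by rewrite cone_evalE map_polyC hornerC. Qed.

Lemma laurent_cone_eval z F : laurent_in rc (fun tau => cone_eval z tau F).
Proof.
apply: laurent_sum => j; apply: laurentM; first exact: laurent_ev_scale.
exact/laurentX/laurent_self.
Qed.

Lemma ceval_comp_scale (tau : R) (p : A) z :
  ceval (comp_mpoly [tuple tau *: mpolyX R (mnm1 i) | i < m] p) z = ceval p (rc tau *: z).
Proof.
rewrite [RHS]ceval_sumE comp_mpolyE {1}/ceval [map_mpoly _ _]raddf_sum [LHS]raddf_sum.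
apply: eq_bigr => mm _ /=; rewrite map_mpolyZ mevalZ; congr (_ * _).
rewrite !rmorph_prod; apply: eq_bigr => i _; rewrite !rmorphXn; congr (_ ^+ _).
by rewrite tnth_mktuple /= map_mpolyZ mevalZ map_mpolyX mevalXU mxE.
Qed.

Lemma cone_eval_mpoly tau F : exists p : A, forall z, ceval p z = cone_eval z tau F.
Proof.
exists (\sum_(j < size F) tau ^+ j *:
  comp_mpoly [tuple tau *: mpolyX R (mnm1 i) | i < m] F`_j) => z.
rewrite /ceval [map_mpoly _ _]raddf_sum [LHS]raddf_sum; apply: eq_bigr => j _ /=.
rewrite map_mpolyZ mevalZ [RHS]mulrC; congr (_ * _); first exact: rmorphXn.
rewrite -/(ceval _ _) ceval_comp_scale //.
Qed.

(** The ideal, in [A[T]], of the cone over [Z] without its apex. The extra variable [T] singles out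
    one variable over the ring [A], and an element of [A] lies in the ideal exactly when it vanishes
    on all nonzero real multiples of points of [Z]. *)
Definition cone_ideal (Z : set 'rV[C]_m) F :=
  forall z tau, Z z -> tau != 0 -> cone_eval z tau F = 0.

Lemma rc_neq0 tau : tau != 0 -> rc tau != 0.
Proof. by rewrite fmorph_eq0. Qed.

(** If [F] and [G] are both nonzero somewhere on the cone, they are so at a common scale [tau]. At
    that [tau] they become real polynomials in [z], to which the irreducibility of [Z] applies. *)
Lemma cone_ideal_prime (Z : set 'rV[C]_m) F G : zariski_irreducible Z ->
  cone_ideal Z (F * G) -> cone_ideal Z F \/ cone_ideal Z G.
Proof.
move=> [_ irrZ] FG; apply: contrapT => /not_orP[].
move=> /existsNP[z1 /existsNP[t1 /not_implyP[Z1 /not_implyP[t10 /eqP Fz]]]].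
move=> /existsNP[z2 /existsNP[t2 /not_implyP[Z2 /not_implyP[t20 /eqP Gz]]]].
have [||j [Fj Gj]] := laurent_common_neq0 (laurent_cone_eval z1 F)
    (laurent_cone_eval z2 G) (@rc_nat_inj R).
- exact: (ex_intro2 _ _ t1 (rc_neq0 t10) Fz).
- exact: (ex_intro2 _ _ t2 (rc_neq0 t20) Gz).
have [p pE] := cone_eval_mpoly j.+1%:R F; have [q qE] := cone_eval_mpoly j.+1%:R G.
have [||z Zz|/(_ _ Z1) /=|/(_ _ Z2) /=] := irrZ [set z | ceval p z = 0] [set z | ceval q z = 0].
- by exists [set p]; apply/seteqP; split=> x /= => [px r ->|/(_ p erefl)].
- by exists [set q]; apply/seteqP; split=> x /= => [px r ->|/(_ q erefl)].
- have := FG z j.+1%:R Zz; rewrite pnatr_eq0 => /(_ isT) /eqP; rewrite cone_evalM mulf_eq0.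
  by case/orP => /eqP h; [left|right]; rewrite /= ?pE ?qE.
- by rewrite pE => h; move/eqP: Fj.
- by rewrite qE => h; move/eqP: Gj.
Qed.

Definition cone_lift (f : A) : {poly A} :=
  \sum_(mm <- msupp f) (mcoeff mm f *: mpolyX R mm) *: 'X^(msize f - mdeg mm).

Lemma cone_lift_neq0 f : f != 0 -> cone_lift f != 0.
Proof.
apply: contraNneq => lf0; have := congr1 (fun F : {poly A} => F.[1]) lf0.
rewrite horner0 /cone_lift horner_sum => e; apply/eqP; rewrite -[RHS]e [LHS]mpolyE.
by apply: eq_bigr => mm _; rewrite hornerZ hornerXn expr1n mulr1.
Qed.

Lemma cone_eval_lift z tau f : cone_eval z tau (cone_lift f) = rc tau ^+ msize f * ceval f z.
Proof.
rewrite cone_evalE /cone_lift rmorph_sum horner_sum ceval_sumE mulr_sumr.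
rewrite big_seq [RHS]big_seq; apply: eq_bigr => mm /msize_mdeg_lt/ltnW mf.
rewrite /= map_polyZ map_polyXn hornerZ hornerXn /= map_mpolyZ mevalZ map_mpolyX mevalX.
rewrite [RHS]mulrCA -mulrA; congr (_ * _).
rewrite -[in RHS](subnK mf) exprD -mulrA mulrC; congr (_ * _).
rewrite mdegE -prodrXr -big_split; apply: eq_bigr => i _ /=.
by rewrite mxE exprMn.
Qed.

(* The hypothesis on the cone over [Z] says that [Z] has codimension at most one. *)
Lemma irreducible_maximal (Z Z' : set 'rV[C]_m) (f : A) :
  zariski_irreducible Z' -> Z `<=` Z' ->
  f != 0 -> (forall z, Z' z -> ceval f z = 0) ->
  (forall a : A, (forall z tau, Z z -> tau != 0 -> ceval a (rc tau *: z) = 0) -> a = 0) ->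
  forall p : A, (forall z, Z z -> ceval p z = 0) -> forall z, Z' z -> ceval p z = 0.
Proof.
move=> irrZ' ZZ' f0 fZ' Zcone p pZ z Z'z.
have lift_ideal Y q : (forall y, Y y -> ceval q y = 0) -> cone_ideal Y (cone_lift q).
  by move=> qY y tau Yy _; rewrite cone_eval_lift qY ?mulr0.
suff /(_ z 1 Z'z) : cone_ideal Z' (cone_lift p).
  by rewrite cone_eval_lift rmorph1 expr1n mul1r; apply; exact: oner_neq0.
apply: (@prime_over_zero_maximal _ (cone_ideal Z') (cone_ideal Z)).
- by move=> F G F0 y tau Yy t0; rewrite cone_evalM F0 ?mulr0.
- by move=> F G; exact: cone_ideal_prime.
- by move=> F F0 y tau /ZZ'; exact: F0.
- by move=> F G F0 G0 y tau Yy t0; rewrite cone_evalB F0 // G0 // subrr.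
- by move=> F G F0 y tau Yy t0; rewrite cone_evalM F0 ?mulr0.
- by move=> a aZ; apply: Zcone => y tau Yy t0; rewrite -cone_evalC; exact: aZ.
- by exists (cone_lift f); [exact: lift_ideal|exact: cone_lift_neq0].
- exact: lift_ideal.
Qed.

End ConeIdeal.

(** * Caratheodory's theorem *)

Section Caratheodory.
Variables (R : realType) (m : nat).
Implicit Types (A : set 'rV[R]_m) (x y : 'rV[R]_m).

Lemma convex_setE A : convex_set A <->
  forall x y (a : R), A x -> A y -> 0 <= a <= 1 -> A (a *: x + (1 - a) *: y).
Proof.
split=> [cA x y a Ax Ay /andP[a0 a1]|cA x y l /set_mem Ax /set_mem Ay].
  by have /set_mem := cA x y (Itv01 a0 a1) (mem_set Ax) (mem_set Ay).
by apply/mem_set; apply: (cA x y l%:num) => //; rewrite ge0 le1.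
Qed.

Lemma convex_set_comb A : convex_set A -> forall N (l : nat -> R) (a : nat -> 'rV[R]_m),
  (forall i, (i < N)%N -> 0 <= l i) -> (forall i, (i < N)%N -> A (a i)) ->
  \sum_(i < N) l i = 1 -> A (\sum_(i < N) l i *: a i).
Proof.
move=> /convex_setE cA; elim=> [|N IHN] l a l0 Aa.
  by rewrite big_ord0 => /eqP; rewrite eq_sym oner_eq0.
rewrite !big_ord_recr /= => l1.
have s0 : 0 <= \sum_(i < N) l i.
  by apply: sumr_ge0 => i _; apply: l0; rewrite ltnS ltnW.
have lN : 0 <= l N by exact: l0.
have [lN1|lN_neq1] := eqVneq (l N) 1.
  have /eqP : \sum_(i < N) l i = 0 by lra.
  rewrite psumr_eq0 => [/allP li0|i _]; last by apply: l0; rewrite ltnS ltnW.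
  rewrite big1 => [|i _]; first by rewrite add0r lN1 scale1r; exact: Aa.
  by have /eqP -> := li0 i (mem_index_enum i); rewrite scale0r.
have s_neq0 : 1 - l N != 0 by rewrite subr_eq0 eq_sym.
have -> : \sum_(i < N) l i *: a i = (1 - l N) *: \sum_(i < N) (l i / (1 - l N)) *: a i.
  by rewrite scaler_sumr; apply: eq_bigr => i _; rewrite scalerA mulrC divfK.
rewrite addrC; apply: (cA (a N) _ (l N)); [exact: Aa| |by lra].
apply: (IHN (fun i => l i / (1 - l N)) a) => [i iN|i iN|].
- by rewrite divr_ge0 ?l0 ?ltnS 1?ltnW //; lra.
- by apply: Aa; rewrite ltnS ltnW.
- by rewrite -mulr_suml (_ : \sum_(i < N) l i = 1 - l N) ?divff //; lra.
Qed.

Definition hull_of (N : nat) A : set 'rV[R]_m :=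
  [set x | exists (l : 'I_N -> R) (a : 'I_N -> 'rV[R]_m),
    [/\ forall i, 0 <= l i, forall i, A (a i), \sum_i l i = 1 & x = \sum_i l i *: a i]].

Lemma affine_dependence (N : nat) (a : 'I_N.+1 -> 'rV[R]_m) : (m < N)%N ->
  exists mu : 'I_N.+1 -> R, [/\ exists i, 0 < mu i, \sum_i mu i = 0 & \sum_i mu i *: a i = 0].
Proof.
move=> mN; pose M := row_mx (const_mx 1 : 'cV[R]_N.+1) (\matrix_i a i).
have : kermx M != 0.
  rewrite kermx_eq0 /row_free neq_ltn; apply/orP; left.
  by rewrite (leq_ltn_trans (rank_leq_col M)).
case/rowV0Pn => u /sub_kermxP; rewrite mul_mx_row => uM u0.
have u1 : \sum_i u 0 i = 0.
  have := congr1 (fun B => lsubmx B 0 0) uM; rewrite row_mxKl !mxE => {2}<-.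
  by apply: eq_bigr => i _; rewrite mxE mulr1.
have ua : \sum_i u 0 i *: a i = 0.
  have := congr1 (@rsubmx _ _ _ _) uM; rewrite row_mxKr => h.
  have ua0 : u *m \matrix_i a i = 0 by rewrite h linear0.
  by rewrite -[RHS]ua0 mulmx_sum_row; apply: eq_bigr => i _; rewrite rowK.
have [[i ui]|no_pos] := pselect (exists i, 0 < u 0 i).
  by exists (fun i => u 0 i); split=> //; exists i.
have ule i : 0 <= - u 0 i.
  by rewrite oppr_ge0 leNgt; apply/negP => ui; apply: no_pos; exists i.
have /eqP : \sum_i - u 0 i = 0 by rewrite sumrN u1 oppr0.
rewrite psumr_eq0 // => /allP u_eq0; case/eqP: u0; apply/rowP => i; rewrite mxE.
by have := u_eq0 i (mem_index_enum i); rewrite oppr_eq0 => /eqP.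
Qed.

Lemma hull_of_drop A N : (m < N)%N -> hull_of N.+1 A `<=` hull_of N A.
Proof.
move=> mN x [l [a [l0 Aa l1 ->]]].
have [mu [[i1 mui1] mu0 mua]] := affine_dependence a mN.
(* The ratio [l i / mu i] is least at [i0]: subtracting that multiple of the dependence keeps all
   weights nonnegative and cancels the weight at [i0]. *)
have [i0 mui0 i0_min] := arg_minP (P := fun i => 0 < mu i) (fun i => l i / mu i) mui1.
pose th := l i0 / mu i0; pose l' i := l i - th * mu i.
have th0 : 0 <= th by rewrite divr_ge0 // ltW.
have l'0 i : 0 <= l' i.
  rewrite subr_ge0; case: (ltP 0 (mu i)) => mui.
    by rewrite -ler_pdivlMr //; exact: i0_min.
  by rewrite (le_trans _ (l0 i)) // mulr_ge0_le0.
have l'i0 : l' i0 = 0 by rewrite /l' /th divfK ?subrr // gt_eqF.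
have sl' : \sum_i l' i = 1 by rewrite sumrB -mulr_sumr mu0 mulr0 subr0.
have sl'a : \sum_i l' i *: a i = \sum_i l i *: a i.
  transitivity (\sum_i l i *: a i - th *: \sum_i mu i *: a i).
    by rewrite scaler_sumr -sumrB; apply: eq_bigr => i _; rewrite scalerBl scalerA.
  by rewrite mua scaler0 subr0.
exists (fun i => l' (lift i0 i)), (fun i => a (lift i0 i)); split=> //.
  by rewrite -sl' [RHS](bigD1_ord i0) //= l'i0 add0r.
by rewrite -sl'a [LHS](bigD1_ord i0) //= l'i0 scale0r add0r.
Qed.

Lemma hull_of_bound A N : hull_of N A `<=` hull_of m.+1 A.
Proof.
elim: N => [x [l [a [_ _ ]]]|N IHN].
  by rewrite big_ord0 => /eqP; rewrite eq_sym oner_eq0.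
have [mN|Nm] := ltnP m N; first exact: (subset_trans (hull_of_drop mN) IHN).
move=> x [l [a [l0 Aa l1 ->]]].
(* Short combinations are padded with zero weights; [inord] sends the missing indices to [0], where
   the point chosen is irrelevant. *)
pose l' (i : 'I_m.+1) := if (i < N.+1)%N then l (inord i) else 0.
have sum_l' (V : zmodType) (F : 'I_m.+1 -> V) :
    (forall i : 'I_m.+1, ~~ (i < N.+1)%N -> F i = 0) ->
    \sum_i F i = \sum_(i < N.+1) F (inord i).
  move=> F0; rewrite (bigID (fun i : 'I_m.+1 => (i < N.+1)%N)) /= [X in _ + X]big1 ?addr0 //.
  rewrite (eq_bigr (fun i : 'I_m.+1 => F (inord i))) => [|i _]; last by rewrite inord_val.
  by rewrite -(big_ord_widen _ (fun i => F (inord i))).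
exists l', (fun i => a (inord i)); split=> [i|i||].
- by rewrite /l'; case: ifP.
- exact: Aa.
- rewrite sum_l' => [|i /negPf]; last by rewrite /l' => ->.
  rewrite -[RHS]l1; apply: eq_bigr => i _; rewrite /l' inordK ?ltn_ord ?inord_val //.
  exact: leq_trans (ltn_ord i) _.
- rewrite sum_l' => [|i /negPf]; last by rewrite /l' => ->; rewrite scale0r.
  apply: eq_bigr => i _; rewrite /l' inordK ?ltn_ord ?inord_val //.
  exact: leq_trans (ltn_ord i) _.
Qed.

(** Two combinations of [m + 1] points are merged into one of [2m + 2] points, which is then
    shortened. *)
Lemma hull_of_convex A : convex_set (hull_of m.+1 A).
Proof.
apply/convex_setE => _ _ s [l [a [l0 Aa l1 ->]]] [l' [a' [l'0 Aa' l'1 ->]]] /andP[s0 s1].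
apply: (@hull_of_bound A (m.+1 + m.+1)).
pose F T (f g : 'I_m.+1 -> T) (i : 'I_(m.+1 + m.+1)) :=
  match fintype.split i with inl j => f j | inr j => g j end.
have Fl T f g j : @F T f g (lshift _ j) = f j.
  by rewrite /F; case: splitP => j' /= e; [congr f; exact: val_inj|have := ltn_ord j; rewrite e; lia].
have Fr T f g j : @F T f g (rshift _ j) = g j.
  by rewrite /F; case: splitP => j' /= e; [have := ltn_ord j'; rewrite -e; lia|congr g; apply: val_inj; move: e => /addnI].
exists (F _ (fun i => s * l i) (fun i => (1 - s) * l' i)), (F _ a a'); split.
- by move=> i; rewrite /F; case: (fintype.split i) => j; rewrite mulr_ge0 // subr_ge0.
- by move=> i; rewrite /F; case: (fintype.split i) => j.
- rewrite big_split_ord /=; under eq_bigr do rewrite Fl; under [X in _ + X]eq_bigr do rewrite Fr.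
  by rewrite -!mulr_sumr l1 l'1; ring.
- rewrite big_split_ord /= !scaler_sumr.
  by congr (_ + _); apply: eq_bigr => i _; rewrite ?Fl ?Fr scalerA.
Qed.

Lemma caratheodory A : convex_hull A = hull_of m.+1 A.
Proof.
apply/seteqP; split.
  apply: smallest_sub; first exact: hull_of_convex.
  move=> x Ax; apply: (@hull_of_bound A 1); exists (fun=> 1), (fun=> x).
  by split=> //; rewrite big_ord1 // scale1r.
move=> _ [l [a [l0 Aa l1 ->]]] B [cB AB].
have inordE (V : zmodType) (F : 'I_m.+1 -> V) : \sum_i F i = \sum_(i < m.+1) F (inord i).
  by apply: eq_bigr => i _; rewrite inord_val.
rewrite inordE; apply: (@convex_set_comb B cB _ (fun i => l (inord i)) (fun i => a (inord i))).
- by move=> i _; exact: l0.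
- by move=> i _; apply: AB.
- by rewrite -[RHS]l1 [RHS]inordE.
Qed.

End Caratheodory.

(** * Boundaries of semialgebraic sets *)

Section Semialgebraic.
Variables (R : realType) (m : nat).
Implicit Types (x y : 'rV[R]_m) (f : ord.formula R).

Lemma continuous_ev (p : mpoly m R) : continuous (fun x => ev x p).
Proof.
elim/mpoly_ring_ind: p => [a|i|p q cp cq|p q cp cq].
- rewrite (_ : (fun x => _) = cst a); last by apply/funext => x; rewrite /ev mevalC.
  by move=> x; exact: cst_continuous.
- rewrite (_ : (fun x => _) = (fun x => x 0 i)); last first.
    by apply/funext => x; rewrite /ev mevalXU.
  by move=> x; exact: coord_continuous.
- rewrite (_ : (fun x => _) = (fun x => ev x p + ev x q)); last first.
    by apply/funext => x; rewrite /ev mevalD.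
  by move=> x; apply: continuousD; [exact: cp|exact: cq].
rewrite (_ : (fun x => _) = (fun x => ev x p * ev x q)); last first.
  by apply/funext => x; rewrite /ev mevalM.
by move=> x; apply: continuousM; [exact: cp|exact: cq].
Qed.

Definition env x : seq R := mkseq (fun i => if insub i is Some j then x 0 j else 0) m.

(** Inverses get the default [0]; the translation is used only for terms satisfying [GRing.rterm],
    which contain none. *)
Fixpoint mpoly_of_term (t : GRing.term R) : mpoly m R :=
  match t with
  | GRing.Var i => if insub i is Some j then mpolyX R (mnm1 j) else 0
  | GRing.Const a => mpolyC m a
  | GRing.NatConst d => d%:R
  | GRing.Add t1 t2 => mpoly_of_term t1 + mpoly_of_term t2
  | GRing.Opp t1 => - mpoly_of_term t1
  | GRing.NatMul t1 d => mpoly_of_term t1 *+ d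
  | GRing.Mul t1 t2 => mpoly_of_term t1 * mpoly_of_term t2
  | GRing.Inv _ => 0
  | GRing.Exp t1 d => mpoly_of_term t1 ^+ d
  end.

Lemma eval_env t x : GRing.rterm t -> GRing.eval (env x) t = ev x (mpoly_of_term t).
Proof.
rewrite /ev; elim: t => //=.
- move=> i _; rewrite /env; case: insubP => [j ij <-|im].
    by rewrite mevalXU nth_mkseq ?ltn_ord // [insub _]valK.
  by rewrite meval0 nth_default // size_mkseq leqNgt.
- by move=> a _; rewrite mevalC.
- by move=> d _; rewrite rmorph_nat.
- by move=> t1 IH1 t2 IH2 /andP[/IH1 -> /IH2 ->]; rewrite mevalD.
- by move=> t1 IH1 /IH1 ->; rewrite mevalN.
- by move=> t1 IH1 d /IH1 ->; rewrite mevalMn.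
- by move=> t1 IH1 t2 IH2 /andP[/IH1 -> /IH2 ->]; rewrite mevalM.
- by move=> t1 IH1 d /IH1 ->; rewrite rmorphXn.
Qed.

Definition locally_constant_off (F : mpoly m R) (b : 'rV[R]_m -> bool) :=
  forall x, ev x F != 0 -> \forall y \near x, b y = b x.

(** A comparison with [0] depends only on the sign, which is stable near a point where [p] is
    nonzero. For [p = 0] the comparison is constant and [F = 1] serves. *)
Lemma sign_locally_constant (op : rel R) (p : mpoly m R) :
  (forall a b, 0 < a * b -> op a 0 = op b 0) ->
  exists2 F : mpoly m R, F != 0 & locally_constant_off F (fun x => op (ev x p) 0).
Proof.
move=> op_sign; have [->|p0] := eqVneq p 0.
  exists 1; first exact: oner_neq0.
  by move=> x _; near=> y; rewrite /ev !meval0.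
exists p => // x px; have : \forall y \near x, 0 < ev y p * ev x p.
  have cx : {for x, continuous (fun y => ev y p * ev x p)}.
    by apply: continuousM; [exact: continuous_ev|exact: cst_continuous].
  apply: (cvgr_gt _ cx); rewrite -expr2 lt_neqAle sqr_ge0 andbT eq_sym.
  by rewrite expf_neq0.
by apply: filterS => y /op_sign.
Unshelve. all: by end_near.
Qed.

Lemma locally_constant_comb (op : bool -> bool -> bool) b1 b2 :
  (exists2 F : mpoly m R, F != 0 & locally_constant_off F b1) ->
  (exists2 F : mpoly m R, F != 0 & locally_constant_off F b2) ->
  exists2 F : mpoly m R, F != 0 & locally_constant_off F (fun x => op (b1 x) (b2 x)).
Proof.
move=> [F F0 hF] [G G0 hG]; exists (F * G); first by rewrite mulf_neq0.
move=> x; rewrite /ev mevalM mulf_eq0 negb_or => /andP[Fx Gx].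
by apply: filterS2 (hF x Fx) (hG x Gx) => y -> ->.
Qed.

Lemma locally_constant_ext b1 b2 : b1 =1 b2 ->
  (exists2 F : mpoly m R, F != 0 & locally_constant_off F b1) ->
  exists2 F : mpoly m R, F != 0 & locally_constant_off F b2.
Proof.
move=> b12 [F F0 hF]; exists F => // x /hF.
by apply: filterS => y; rewrite !b12.
Qed.

Lemma qf_locally_constant f : ord.qf_form f -> ord.rformula f ->
  exists2 F : mpoly m R, F != 0 & locally_constant_off F (fun x => ord.qf_eval (env x) f).
Proof.
elim: f => //=.
- move=> b _ _; exists 1; first exact: oner_neq0.
  by move=> x _; near=> y.
- move=> t1 t2 _ /andP[r1 r2].
  have [|F F0 hF] := @sign_locally_constant (fun a b => a == b) (mpoly_of_term t1 - mpoly_of_term t2).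
    by move=> a b ab; have := lt0r_neq0 ab; rewrite mulf_eq0 negb_or => /andP[/negPf -> /negPf ->].
  apply: locally_constant_ext (ex_intro2 _ _ F F0 hF) => x.
  by rewrite !eval_env // /ev mevalB subr_eq0.
- move=> t1 t2 _ /andP[r1 r2].
  have [|F F0 hF] := @sign_locally_constant (fun a b => a < b) (mpoly_of_term t1 - mpoly_of_term t2).
    by move=> a b ab; apply/idP/idP => ?; nra.
  apply: locally_constant_ext (ex_intro2 _ _ F F0 hF) => x.
  by rewrite !eval_env // /ev mevalB subr_lt0.
- move=> t1 t2 _ /andP[r1 r2].
  have [|F F0 hF] := @sign_locally_constant (fun a b => a <= b) (mpoly_of_term t1 - mpoly_of_term t2).
    by move=> a b ab; apply/idP/idP => ?; nra.
  apply: locally_constant_ext (ex_intro2 _ _ F F0 hF) => x.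
  by rewrite !eval_env // /ev mevalB subr_le0.
- move=> f1 IH1 f2 IH2 /andP[q1 q2] /andP[r1 r2].
  exact: (locally_constant_comb andb (IH1 q1 r1) (IH2 q2 r2)).
- move=> f1 IH1 f2 IH2 /andP[q1 q2] /andP[r1 r2].
  exact: (locally_constant_comb orb (IH1 q1 r1) (IH2 q2 r2)).
- move=> f1 IH1 f2 IH2 /andP[q1 q2] /andP[r1 r2].
  exact: (locally_constant_comb implb (IH1 q1 r1) (IH2 q2 r2)).
- move=> f1 IH1 q1 r1; have := IH1 q1 r1 => h1.
  exact: (locally_constant_comb (fun b _ => ~~ b) h1 h1).
Unshelve. all: by end_near.
Qed.

(* Quantifier elimination: off the zero set of the product of the nonzero
   polynomials of a quantifier-free description, membership is locally constant. *)
Lemma boundary_zeros f (S : set 'rV[R]_m) : (forall x, ord.holds (env x) f <-> S x) ->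
  exists2 F : mpoly m R, F != 0 & forall x, (closure S `\` S°) x -> ev x F = 0.
Proof.
move=> fS; pose g := ord.quantifier_elim (@wproj R) (ord.to_rform f).
have /andP[qg rg] := ord.quantifier_elim_wf (@wf_QE_wproj R) (ord.to_rform_rformula f).
have gS x : ord.qf_eval (env x) g <-> S x.
  rewrite -fS; split; first by move=> h; apply/rcf_satP.
  by move/rcf_satP.
have [F F0 hF] := qf_locally_constant qg rg; exists F => // x [clSx not_int].
apply/eqP/negPn/negP => /hF near_x.
have [Sx|nSx] := pselect (S x).
  by apply: not_int; apply: filterS near_x => y yx; apply/gS; rewrite yx; apply/gS.
have [y [Sy yx]] := clSx _ near_x; apply: nSx; apply/gS; rewrite -yx.
exact/gS.
Qed.

End Semialgebraic.

(** * The orbitope is semialgebraic *)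

Section OrbitopeFormula.
Variable R : realType.
Implicit Types (e : seq R) (f : ord.formula R).

Definition ord_exists (i K : nat) f : ord.formula R :=
  foldr (fun j g => ord.Exists j g) f (iota i K).

Definition ord_forall (K : nat) (F : nat -> ord.formula R) : ord.formula R :=
  foldr (fun i g => ord.And (F i) g) (ord.Bool true) (iota 0 K).

Definition term_sum (K : nat) (F : nat -> GRing.term R) : GRing.term R :=
  foldr (fun i g => GRing.Add (F i) g) (GRing.NatConst R 0) (iota 0 K).

(** The addition formulas make [cos (j t)] and [sin (j t)] polynomial in [U = cos t] and
    [V = sin t]; the angle itself is replaced in the formula by a point of the unit circle. *)
Fixpoint term_cos_sin (U V : GRing.term R) (j : nat) : GRing.term R * GRing.term R :=
  if j is j'.+1 then
    let CS := term_cos_sin U V j' in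
    (GRing.Add (GRing.Mul CS.1 U) (GRing.Opp (GRing.Mul CS.2 V)),
     GRing.Add (GRing.Mul CS.2 U) (GRing.Mul CS.1 V))
  else (GRing.NatConst R 1, GRing.NatConst R 0).

Lemma holds_and f g e : ord.holds e (ord.And f g) <-> ord.holds e f /\ ord.holds e g.
Proof. by []. Qed.

Lemma holds_ord_exists i K f e : size e = i ->
  ord.holds e (ord_exists i K f) <-> exists g, ord.holds (e ++ mkseq g K) f.
Proof.
move=> <-; elim: K e => [|K IHK] e /=.
  by split=> [h|[g]]; [exists (fun=> 0)|]; rewrite cats0.
have mkS (g : nat -> R) : mkseq g K.+1 = g 0%N :: mkseq (g \o succn) K.
  by rewrite /mkseq /= -[1%N]addn0 iotaDl -map_comp.
have setE x : set_nth 0 e (size e) x = rcons e x by elim: (e) => //= a s ->.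
split=> [[x]|[g]].
  rewrite setE -[(size e).+1](size_rcons e x) => /IHK[g h].
  exists (fun i => if i is i'.+1 then g i' else x).
  by rewrite mkS -cat_rcons.
rewrite mkS -cat_rcons => h; exists (g 0%N).
by rewrite setE -[(size e).+1](size_rcons e (g 0%N)); apply/IHK; exists (g \o succn).
Qed.

Lemma holds_ord_forall K F e :
  ord.holds e (ord_forall K F) <-> forall i, (i < K)%N -> ord.holds e (F i).
Proof.
rewrite /ord_forall -[in X in _ <-> X](size_iota 0 K).
have -> : (forall i, (i < size (iota 0 K))%N -> ord.holds e (F i)) <->
          (forall i, i \in iota 0 K -> ord.holds e (F i)).
  by split=> h i; have := h i; rewrite mem_iota size_iota.
elim: (iota 0 K) => //= i s IHs; rewrite IHs; split=> [[Fi Fs] j|h].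
  by rewrite inE => /orP[/eqP -> //|]; exact: Fs.
by split=> [|j js]; apply: h; rewrite inE ?eqxx ?js ?orbT.
Qed.

Lemma eval_term_sum K F e :
  GRing.eval e (term_sum K F) = \sum_(i < K) GRing.eval e (F i).
Proof.
rewrite -(big_mkord xpredT (fun i => GRing.eval e (F i))) /index_iota subn0 /term_sum.
by elim: (iota 0 K) => [|i s IHs] /=; rewrite ?big_nil ?big_cons ?IHs.
Qed.

Lemma eval_term_cos_sin U V e t j :
  GRing.eval e U = cos t -> GRing.eval e V = sin t ->
  GRing.eval e (term_cos_sin U V j).1 = cos (j%:R * t) /\
  GRing.eval e (term_cos_sin U V j).2 = sin (j%:R * t).
Proof.
move=> Ut Vt; elim: j => [|j [IHc IHs]] /=; first by rewrite mul0r cos0 sin0.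
by rewrite IHc IHs Ut Vt mulrSr mulrDl mul1r cosD sinD.
Qed.

Lemma unit_circle_param (u v : R) : u ^+ 2 + v ^+ 2 = 1 ->
  exists2 t, 0 <= t <= 2 * pi & u = cos t /\ v = sin t.
Proof.
move=> uv; have u1 : -1 <= u <= 1.
  by rewrite -ler_norml -(expr_le1 (n := 2)) // -normrX ger0_norm ?sqr_ge0 // -uv lerDl sqr_ge0.
have a0 := acos_ge0 u1; have api := acos_lepi u1; have pi0 := pi_gt0 R.
have sE : sin (acos u) = `|v|.
  by rewrite sin_acos // -uv addrAC subrr add0r sqrtr_sqr.
have [v0|v0] := lerP 0 v.
  exists (acos u); first lra.
  by rewrite acosK ?in_itv //= sE ger0_norm.
exists (2 * pi - acos u); first lra.
have -> : 2 * pi - acos u = pi + (pi - acos u) by ring.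
have cE : cos (pi - acos u) = - u by rewrite cosB cospi sinpi acosK ?in_itv //=; ring.
have sE' : sin (pi - acos u) = - v.
  by rewrite sinB cospi sinpi sE (ltr0_norm v0); ring.
by rewrite (cosD pi (_ - _)) (sinD pi (_ - _)) cospi sinpi cE sE'; split; ring.
Qed.

Arguments ord_forall : simpl never.
Arguments term_sum : simpl never.
Arguments term_cos_sin : simpl never.

Variable n : nat.
Local Notation N := n.+2.

(* Variables [0 .. n] are the coordinates of the point; the next three blocks of
   [N] hold the weights, the cosines and the sines of a Caratheodory combination. *)
Definition orbitope_formula : ord.formula R :=
  let X := @GRing.Var R in
  let l i := X (n.+1 + i)%N in
  let u i := X (n.+1 + (N + i))%N in
  let v i := X (n.+1 + (N + (N + i)))%N in
  ord_exists n.+1 (N + (N + N)) (ord.And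
    (ord_forall N (fun i => ord.And (ord.Le (GRing.NatConst R 0) (l i))
      (ord.Equal (GRing.Add (GRing.Exp (u i) 2) (GRing.Exp (v i) 2)) (GRing.NatConst R 1))))
    (ord.And (ord.Equal (term_sum N l) (GRing.NatConst R 1))
      (ord_forall n.+1 (fun j => ord.Equal (X j) (term_sum N (fun i => GRing.Mul (l i)
         (if odd j then (term_cos_sin (u i) (v i) j).2
          else (term_cos_sin (u i) (v i) j.+1).1))))))).

Lemma orbitope_formulaP (x : 'rV[R]_n.+1) :
  ord.holds (env x) orbitope_formula <-> bn_orbitope R n x.
Proof.
have env_size : size (env x) = n.+1 by rewrite size_mkseq.
have env_nth (j : 'I_n.+1) w : nth 0 (env x ++ w) j = x 0 j.
  rewrite nth_cat env_size ltn_ord nth_mkseq ?ltn_ord //.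
  by rewrite [insub _]valK.
have w_nth g K q : (q < K)%N -> nth 0 (env x ++ mkseq g K) (n.+1 + q) = g q.
  by move=> qK; rewrite nth_cat env_size -ltn_subRL subnn /= addKn nth_mkseq.
rewrite /bn_orbitope caratheodory /orbitope_formula (holds_ord_exists _ _ env_size).
split.
  move=> [g].
  have xj (j : 'I_n.+1) : nth 0 (env x ++ mkseq g (N + (N + N))) j = x 0 j by exact: env_nth.
  have lE i : (i < N)%N -> nth 0 (env x ++ mkseq g (N + (N + N))) (n.+1 + i) = g i.
    by move=> iN; rewrite w_nth // ltn_addr.
  move: (env x ++ _) xj lE => e xj lE /holds_and[].
  move=> /holds_ord_forall hl /holds_and[hsum /holds_ord_forall hx].
  have hl' i : exists t, (i < N)%N ->
      [/\ 0 <= g i, 0 <= t <= 2 * pi, nth 0 e (n.+1 + (N + i)) = cos t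
        & nth 0 e (n.+1 + (N + (N + i))) = sin t].
    have [iN|iN] := ltnP i N; last by exists 0.
    have [l0 uv] : 0 <= nth 0 e (n.+1 + i) /\
      nth 0 e (n.+1 + (N + i)) ^+ 2 + nth 0 e (n.+1 + (N + (N + i))) ^+ 2 = 1 := hl i iN.
    have [t t2 [ut vt]] := unit_circle_param uv.
    by exists t => _; split=> //; rewrite -lE.
  have [t tP] := choice hl'.
  exists (fun i => g i), (fun i => bn_point n (t i)); split.
  - by move=> i; have [] := tP i (ltn_ord i).
  - by move=> i; exists (t i) => //; have [_ ? _ _] := tP i (ltn_ord i); rewrite /= in_itv.
  - have <- : GRing.eval e _ = 1 := hsum.
    by rewrite eval_term_sum; apply: eq_bigr => i _; rewrite -[LHS]lE.
  apply/rowP => j; rewrite summxE -xj.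
  have -> : nth 0 e j = GRing.eval e _ := hx j (ltn_ord j).
  rewrite eval_term_sum; apply: eq_bigr => i _.
  rewrite mxE -[g i]lE //; congr (_ * _); rewrite mxE.
  have [_ _ ut vt] := tP i (ltn_ord i).
  have trig := @eval_term_cos_sin (GRing.Var R (n.+1 + (N + i)))
      (GRing.Var R (n.+1 + (N + (N + i)))) e (t i) _ ut vt.
  by case: (odd j); [exact: (trig j).2|exact: (trig j.+1).1].
move=> [l [a [l0 Aa l1 xE]]].
have /choice[t tP] : forall i, exists t, bn_point n t = a i.
  by move=> i; have [t _ <-] := Aa i; exists t.
pose g q := if (q < N)%N then l (inord q) else
  if (q < N + N)%N then cos (t (inord (q - N))) else sin (t (inord (q - (N + N)))).
exists g.
have xj (j : 'I_n.+1) : nth 0 (env x ++ mkseq g (N + (N + N))) j = x 0 j by exact: env_nth.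
set e := _ ++ _ in xj *.
have lE i : (i < N)%N -> nth 0 e (n.+1 + i) = l (inord i).
  by move=> iN; rewrite w_nth /g ?iN // ltn_addr.
have uE i : (i < N)%N -> nth 0 e (n.+1 + (N + i)) = cos (t (inord i)).
  move=> iN; rewrite w_nth ?ltn_add2l ?ltn_addr // /g ltn_add2l iN addKn.
  by rewrite ltnNge leq_addr.
have vE i : (i < N)%N -> nth 0 e (n.+1 + (N + (N + i))) = sin (t (inord i)).
  move=> iN; rewrite w_nth ?ltn_add2l // /g addnA addKn.
  by rewrite [X in if X then _ else _]ltnNge -addnA leq_addr /= addnA ltnNge leq_addr.
move: e xj lE uE vE => e xj lE uE vE.
apply/holds_and; split; first apply/holds_ord_forall => i iN.
  suff : 0 <= nth 0 e (n.+1 + i) /\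
    nth 0 e (n.+1 + (N + i)) ^+ 2 + nth 0 e (n.+1 + (N + (N + i))) ^+ 2 = 1 by [].
  by rewrite lE // uE // vE // l0 cos2Dsin2.
apply/holds_and; split.
  suff : GRing.eval e (term_sum N (fun i => GRing.Var R (n.+1 + i))) = 1 by [].
  rewrite eval_term_sum -[RHS]l1; apply: eq_bigr => i _.
  by rewrite -[i in RHS]inord_val -lE.
apply/holds_ord_forall => j jn.
suff : nth 0 e j = GRing.eval e (term_sum N (fun i => GRing.Mul (GRing.Var R (n.+1 + i))
         (if odd j then (term_cos_sin (GRing.Var R (n.+1 + (N + i)))
            (GRing.Var R (n.+1 + (N + (N + i)))) j).2
          else (term_cos_sin (GRing.Var R (n.+1 + (N + i)))
            (GRing.Var R (n.+1 + (N + (N + i)))) j.+1).1))) by [].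
rewrite eval_term_sum (xj (Ordinal jn)) xE summxE; apply: eq_bigr => i _.
rewrite mxE -[i in l i]inord_val -lE //; congr (_ * _); rewrite -tP mxE /=.
have ut := uE i (ltn_ord i); have vt := vE i (ltn_ord i); rewrite inord_val in ut vt.
have trig := @eval_term_cos_sin (GRing.Var R (n.+1 + (N + i)))
  (GRing.Var R (n.+1 + (N + (N + i)))) e (t i) _ ut vt.
by apply/esym; case: (odd j); [exact: (trig j).2|exact: (trig j.+1).1].
Qed.

End OrbitopeFormula.

(** * The algebraic boundary *)

Section AlgebraicBoundary.
Variables (R : realType) (k : nat).
Local Notation C := R[i].
Local Notation rc := (real_complex R).
Local Notation n := (k.*2.+1).
Local Notation c := (bn_point n).

Lemma convex_halfspace m (u : 'rV[R]_m) (b : R) : convex_set [set x | dotr u x <= b].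
Proof.
apply/convex_setE => x y a /= xb yb a01.
have -> : dotr u (a *: x + (1 - a) *: y) = a * dotr u x + (1 - a) * dotr u y.
  rewrite /dotr !mulr_sumr -big_split; apply: eq_bigr => i _ /=.
  by rewrite !mxE; ring.
by nra.
Qed.

Lemma dotr_gt0 m (u : 'rV[R]_m) : u != 0 -> 0 < dotr u u.
Proof.
move=> u0; rewrite lt_neqAle sumr_ge0 ?andbT => [|i _]; last by rewrite -expr2 sqr_ge0.
rewrite eq_sym; apply: contra u0; rewrite psumr_eq0 => [/allP h|i _]; last by rewrite -expr2 sqr_ge0.
apply/eqP/rowP => i; rewrite mxE.
by have := h i (mem_index_enum i); rewrite /= mulf_eq0 orbb => /eqP.
Qed.

(** A small step from [x] in the direction [u] would stay in [A] and increase the functional. *)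
Lemma max_functional_not_interior m (A : set 'rV[R]_m) (u x : 'rV[R]_m) :
  u != 0 -> (forall y, A y -> dotr u y <= dotr u x) -> ~ A° x.
Proof.
move=> u0 ux Ax.
have line_cvg : (fun s : R => x + s *: u) @ (0 : R) --> x + (0 : R) *: u.
  by apply: cvgD; [exact: cvg_cst|apply: cvgZr_tmp; exact: cvg_id].
rewrite scale0r addr0 in line_cvg.
have [e /= e0 eA] := line_cvg _ Ax.
have e2 : 0 < e / 2 by rewrite divr_gt0.
have /ux : A (x + (e / 2) *: u).
  by apply: eA; rewrite /ball /= sub0r normrN gtr0_norm //; lra.
have -> : dotr u (x + (e / 2) *: u) = dotr u x + e / 2 * dotr u u.
  rewrite /dotr mulr_sumr -big_split; apply: eq_bigr => i _ /=.
  by rewrite !mxE; ring.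
by rewrite gerDl leNgt mulr_gt0 // dotr_gt0.
Qed.

Lemma open_secants_boundary (y : 'rV[R]_n.+1) : open_secants y ->
  (closure (bn_orbitope R n) `\` (bn_orbitope R n)°) y.
Proof.
move=> [l [t [l0 tP l1 yE]]].
have on_curve i : (i <= k)%N -> bn_trig_curve R n (c (t i)).
  move=> ik; exists (t i) => //=; have := arcs_bound tP ik.
  by have := pi_gt0 R; rewrite in_itv /=; lra.
have [c0 [u [u0 ut u_le]]] : exists c0 u, [/\ u != 0,
    forall i, (i <= k)%N -> dotr u (c (t i)) = c0
    & forall s, 0 <= s <= 2 * pi -> dotr u (c s) <= c0].
  have t_incr i : (i < k)%N -> t i < t i.+1.
    by move=> ik; apply: (arcs_incr tP); rewrite ltnSn.
  apply: supporting_functional => //.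
    by have /andP[/ltW] := arcs_bound tP (leq0n k).
  by have /andP[_ /ltW] := arcs_bound tP (leqnn k).
split.
  apply: subset_closure => B [cB curveB]; rewrite yE.
  apply: (@convex_set_comb _ _ B cB _ l (fun i => c (t i))) => //.
    by move=> i ik; exact/ltW/l0.
  by move=> i ik; exact/curveB/on_curve.
have uy : dotr u y = c0.
  rewrite yE -[RHS]mul1r -l1 mulr_suml /dotr.
  under eq_bigr do rewrite summxE mulr_sumr.
  rewrite exchange_big; apply: eq_bigr => i _ /=.
  rewrite -(ut i (ltn_ord i)) /dotr mulr_sumr; apply: eq_bigr => j _.
  by rewrite [in LHS]mxE mulrCA.
apply: (max_functional_not_interior u0); rewrite uy.
apply: (@smallest_sub _ _ _ [set x | dotr u x <= c0]); first exact: convex_halfspace.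
by move=> _ [s s2 <-] /=; apply: u_le; move: s2; rewrite /= in_itv.
Qed.

(** Homogenization transfers the question to the sum of the cones over the arcs, whose points are
    positive multiples of chart points of [open_secants]. *)
Lemma open_secants_prime (p q : mpoly n.+1 R) :
  (forall y, open_secants y -> ceval p (map_mx rc y) * ceval q (map_mx rc y) = 0) ->
  (forall y, open_secants y -> ceval p (map_mx rc y) = 0) \/
  (forall y, open_secants y -> ceval q (map_mx rc y) = 0).
Proof.
move=> pq0.
pose S i := @arc_cone R n (arc_end R k i) (arc_end R k i.+1).
have irrS : cone_irreducible (minkowski k.+1 S).
  apply: minkowski_irreducible => i ik; apply: arc_cone_irreducible.
    exact: arc_end_lt.
  have := @arc_end_le R k 0 i isT; have := @arc_end_le R k i.+1 k.+1 ik.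
  by rewrite arc_end0 arc_endS; have := pi_gt0 R; lra.
have zero_of (r : mpoly n.+1 R) :
    (forall x, minkowski k.+1 S x -> ev x (map_mpoly rc (homogenize r)) = 0) ->
    forall y, open_secants y -> ceval r (map_mx rc y) = 0.
  move=> r0 y [l [t [l0 tP l1 yE]]].
  have := r0 _ (open_secants_cone l0 tP); rewrite -cevalE.
  rewrite (homog_coord_sum (fun i => c (t i)) (oner_neq0 _) l1) scale1r.
  rewrite ceval_homogenize => <-; congr (ceval _ (map_mx _ _)).
  by rewrite yE; apply: eq_bigr => i _; rewrite divr1.
have [x /cone_open_secants[tau [y [tau0 Ty ->]]]|h|h] :=
    irrS (map_mpoly rc (homogenize p)) (map_mpoly rc (homogenize q)).
- have scale r : ev (rc tau *: homog_coord (map_mx rc y)) (map_mpoly rc (homogenize r))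
      = rc tau ^+ msize r * ceval r (map_mx rc y).
    by rewrite -cevalE (ceval_scale_homog _ _ (homogenize_homog r)) ceval_homogenize.
  apply: (etrans (congr2 *%R (scale p) (scale q))).
  by rewrite mulrACA (pq0 y Ty) mulr0.
- by left; exact: zero_of.
- by right; exact: zero_of.
Qed.

Lemma cone_point_open_secants (l t : nat -> R) :
  (forall i, (i <= k)%N -> 0 < l i) -> in_arcs k t ->
  exists tau y, [/\ tau != 0, open_secants y & cone_point k l t = tau *: y].
Proof.
move=> l0 tP; pose tau := \sum_(i < k.+1) l i.
have tau0 : 0 < tau.
  rewrite /tau big_ord_recr /= ltr_wpDl //; last exact: l0.
  by apply: sumr_ge0 => i _; apply/ltW/l0/ltnW.
have tau_neq0 : tau != 0 by rewrite gt_eqF.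
exists tau, (\sum_(i < k.+1) (l i / tau) *: c (t i)); split=> //.
  exists (fun i => l i / tau), t; split=> //; first by move=> i ik; rewrite divr_gt0 ?l0.
  by rewrite -mulr_suml divff.
rewrite scaler_sumr; apply: eq_bigr => i _.
by rewrite scalerA mulrC divfK.
Qed.

Let secants := affine_part (secant_variety k (bn_proj_curve R n)).

Lemma secants_irreducible : zariski_irreducible secants.
Proof.
split.
  have [l [t [l0 tP]]] := cone_point_exists R k.
  have [tau [y [_ Ty _]]] := cone_point_open_secants l0 tP.
  by exists (map_mx rc y); exact: open_secants_sub.
move=> _ _ [SV ->] [SW ->] VW; apply: contrapT => /not_orP[].
rewrite /secants affine_secant_varietyE.
move=> /existsNP[x /not_implyP[xZ /existsNP[p /not_implyP[SVp px]]]].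
move=> /existsNP[z /not_implyP[zZ /existsNP[q /not_implyP[SWq qz]]]].
have [y Ty|p0|q0] := @open_secants_prime p q.
- have [|h|h] := VW (map_mx rc y); first exact: open_secants_sub.
    by rewrite (h p SVp) mul0r.
  by rewrite (h q SWq) mulr0.
- exact/px/xZ.
- exact/qz/zZ.
Qed.

Lemma secants_sub_boundary : secants `<=` algebraic_boundary (bn_orbitope R n).
Proof.
rewrite /secants affine_secant_varietyE => x xZ M [[S ->] bdS] p Sp.
apply: xZ => y /open_secants_boundary yB.
by apply: (bdS (map_mx rc y)) => //; exists y.
Qed.

Lemma boundary_equation : exists2 f : mpoly n.+1 R, f != 0 &
  forall z, algebraic_boundary (bn_orbitope R n) z -> ceval f z = 0.
Proof.
have [f f0 f_bd] := boundary_zeros (@orbitope_formulaP R n).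
exists f => //; apply: (@smallest_sub _ _ _ [set z | ceval f z = 0]).
  exact: zariski_closed_zeros.
by move=> _ [y yB <-] /=; rewrite ceval_real f_bd // rmorph0.
Qed.

Lemma secants_component :
  irreducible_component secants (algebraic_boundary (bn_orbitope R n)).
Proof.
split; [exact: secants_sub_boundary|exact: secants_irreducible|].
move=> Z' irrZ' ZZ' Z'Y; apply/seteqP; split=> // z Z'z.
have [f f0 fY] := boundary_equation.
rewrite /secants affine_secant_varietyE => p p0.
apply: (irreducible_maximal irrZ' ZZ' f0 _ _ _ Z'z).
- by move=> y /Z'Y; exact: fY.
(* The codimension hypothesis: every [cone_point] is a nonzero multiple of a point of
   [open_secants], and no nonzero polynomial vanishes at all of them. *)
- move=> a a0; apply: cone_zariski_dense => l t [l0 tP].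
  have [tau [y [tau0 Ty ->]]] := cone_point_open_secants l0 tP.
  have := a0 _ _ (open_secants_sub Ty) tau0.
  by rewrite -map_mxZ ceval_real => /rc_inj.
- by rewrite /secants affine_secant_varietyE => y; apply.
Qed.

End AlgebraicBoundary.

Theorem theorem6p6 (R : realType) (n : nat) (n_odd : odd n) (n_gt2 : (2 < n)%N) :
  irreducible_component
    (affine_part (secant_variety (n.-1)./2 (bn_proj_curve R n)))
    (algebraic_boundary (bn_orbitope R n)).
Proof.
have -> : n = (n./2).*2.+1 by rewrite -[LHS]odd_double_half n_odd.
rewrite /= doubleK; exact: secants_component.
Qed.
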